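(* Let $p\ge 5$ be prime and let $G$ be a primitive but not $2$-fold transitive permutation group of degree $3p$. If $G$ is of Type VII, then $p$ is $7$, $19$ or $31$, and: (i) if $p=7$, the subdegrees of $G$ are $1,4,8,8$; (ii) if $p=19$, the subdegrees of $G$ are $1,6,20,30$; (iii) if $p=31$, the subdegrees of $G$ are $1,20,32,40$.
   Context: Let $\pi$ denote the (complex) permutation character of $G$. $G$ is of Type VII if $\pi=1_G+\chi_1+\chi_2+\chi_3$ where $\chi_1,\chi_2,\chi_3$ are distinct irreducible characters of $G$ of degrees $p+1$, $p-1$, $p-1$ respectively. The subdegrees of $G$ are the lengths of the orbits (suborbits) of a point stabiliser. *)

(* Defs.v *)
From mathcomp Require Import all_boot all_order all_fingroup all_algebra.
From mathcomp Require Import all_solvable all_field all_character.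

Set Implicit Arguments.
Unset Strict Implicit.
Unset Printing Implicit Defensive.

Import GroupScope GRing.Theory.
Local Open Scope ring_scope.

Section PermutationGroups.

Variables (T : finType) (G : {group {perm T}}).

Fact perm_char_subproof :
  is_class_fun <<G>> [ffun g : {perm T} => #|'Fix_'P[g]|%:R *+ (g \in G)].
Proof.
rewrite genGid; apply: intro_class_fun => [g h Gg Gh | g /negbTE-> //].
rewrite groupJ // Gg; congr (_%:R); rewrite -[RHS](card_imset _ (@perm_inj _ h)).
apply: eq_card => y; apply/idP/imsetP => [/afix1P /= fy | [x /afix1P /= fx ->]].
  exists (h^-1%g y); last by rewrite permKV.
  apply/afix1P; move: fy; rewrite /= /aperm conjgE !permM => fy.
  by apply: (@perm_inj _ h); rewrite fy permKV.
apply/afix1P; move: fx; rewrite /= /aperm => fx.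
by rewrite conjgE !permM permK fx.
Qed.

(* The permutation character, counting fixed points; algC contains the values *)
(* of all complex characters of a finite group.                               *)
Definition perm_char : 'CF(G) := Cfun 0 perm_char_subproof.

Lemma perm_charE g : g \in G -> perm_char g = #|'Fix_'P[g]|%:R.
Proof. by move=> Gg; rewrite cfunE Gg. Qed.

Definition type_VII (p : nat) : Prop :=
  exists i j k : Iirr G,
    [/\ [/\ i != j, i != k & j != k],
        perm_char = 1 + 'chi_i + 'chi_j + 'chi_k
      & [/\ 'chi_i 1%g = p.+1%:R, 'chi_j 1%g = p.-1%:R
          & 'chi_k 1%g = p.-1%:R]].

(* Suborbit lengths with multiplicity; compare with perm_eq only, since the   *)
(* order of the list is that of an arbitrary enumeration of the suborbits.    *)
Definition subdegrees (a : T) : seq nat :=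
  [seq #|X| | X : {set T} in orbit 'P 'C_G[a | 'P] @: [set: T]].

End PermutationGroups.

(* Main.v *)
From Stdlib Require Import ZArith Lia.
Require Import Defs.
From mathcomp Require Import all_boot all_order all_fingroup all_algebra.
From mathcomp Require Import all_solvable all_field all_character.

(* The permutation character is multiplicity free of rank 4, so the commutant   *)
(* of G has as a basis the idempotents E_chi = chi(1)/|G| sum_g chi(g^-1) P_g of *)
(* the four constituents, and every orbital matrix A (of valency n) is a linear *)
(* combination n E_1 + lam E_i + mu E_j + nu E_k.                               *)
(*   A Sylow p-subgroup contains an element x of order p acting with three      *)
(* p-cycles.  Since chi_i is the only constituent of degree p + 1, it is fixed  *)
(* by all Galois automorphisms, hence constant on the generators of <x>; this   *)
(* forces chi_i to contain the trivial character of <x> twice, and chi_j, chi_k *)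
(* not at all.  So the quotient of A by the orbits of <x> is                    *)
(* lam I + ((n - lam)/3) J: with diagonal entry d and off-diagonal entry b we   *)
(* get n = d + 2b and lam = d - b.  As mu + nu and |mu|^2 + |nu|^2 are rational *)
(* algebraic integers, the traces of A and A A^* give, for nontrivial A,        *)
(* p - 1 | 3d and p - 1 | 6b(b - 1), while E_i^2 = E_i gives                    *)
(* sum_A lam^2 / n = 3p / (p + 1).  Moreover sum_A d = sum_A b = p.  These      *)
(* Diophantine conditions alone have exactly the three announced solutions.     *)

(** Since each constituent of the permutation character occurs once, there are four suborbits
    ([card_suborbits]), and the invariant matrices are the combinations of four idempotents
    ([invariant_span]). Averaging over a semiregular [x] of order p ([exists_semiregular]) kills
    both constituents of degree p - 1 ([fixdim_jk], [idem_fix_eq0]). Hence a suborbit that meets the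
    <x>-orbit of the base point in d points meets any other <x>-orbit in a common number b of
    points; its length is d + 2b and its eigenvalue on ['chi_i] is d - b ([orbital_spectrum]).
    Integrality of the other two eigenvalues gives divisibilities ([hits_dvd]), and E_i^2 = E_i
    gives a quadratic relation ([sum_suborbit_sqr]).

    The rest is arithmetic ([feasible_admissible]). For the nontrivial suborbits, d_l = (p - 1) t_l
    / 3 with nonnegative integers t_l of sum 3, so t is (1,1,1), (2,1,0) or (3,0,0) up to order. The
    relation reads: the sum of (d_l - b_l)^2 / n_l is (2p - 1) / (p + 1), which is less than 2. With
    the divisibilities it excludes (3,0,0) ([feasible_concentrated_false]) and bounds p in the other
    two cases ([feasible_balanced_bound], [feasible_unbalanced_bound]). A finite search then leaves
    only the announced values. *)

Set Implicit Arguments.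
Unset Strict Implicit.
Unset Printing Implicit Defensive.

(** * The Diophantine problem *)

Section Arithmetic.
Local Open Scope Z_scope.

(* In the application, d_l and b_l are the diagonal and off-diagonal entries of *)
(* the quotient of the l-th orbital matrix by a semiregular element of order p, *)
(* so that its valency is d_l + 2 b_l and its eigenvalue on the constituent of  *)
(* degree p + 1 is d_l - b_l.                                                   *)
Definition feasible (p d1 d2 d3 b1 b2 b3 : Z) : Prop :=
  [/\ 0 <= b1 /\ 0 <= b2 /\ 0 <= b3,
      b1 + b2 + b3 = p,
      [/\ (p - 1 | 6 * (b1 * (b1 - 1))), (p - 1 | 6 * (b2 * (b2 - 1)))
        & (p - 1 | 6 * (b3 * (b3 - 1)))],
      0 < d1 + 2 * b1 /\ 0 < d2 + 2 * b2 /\ 0 < d3 + 2 * b3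
    & (p + 1) * ((d1 - b1) ^ 2 * (d2 + 2 * b2) * (d3 + 2 * b3)
               + (d2 - b2) ^ 2 * (d1 + 2 * b1) * (d3 + 2 * b3)
               + (d3 - b3) ^ 2 * (d1 + 2 * b1) * (d2 + 2 * b2))
    = (2 * p - 1) * ((d1 + 2 * b1) * (d2 + 2 * b2) * (d3 + 2 * b3))].

Definition admissible (p : nat) (n : seq nat) : bool :=
  [|| (p == 7) && perm_eq n [:: 4; 8; 8],
      (p == 19) && perm_eq n [:: 6; 20; 30]
    | (p == 31) && perm_eq n [:: 20; 32; 40]]%nat.

Lemma admissible_perm p m n : perm_eq m n -> admissible p m = admissible p n.
Proof. by move=> /permPl mn; rewrite /admissible !mn. Qed.

Lemma feasible_swap12 p d1 d2 d3 b1 b2 b3 :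
  feasible p d1 d2 d3 b1 b2 b3 -> feasible p d2 d1 d3 b2 b1 b3.
Proof. by case=> b0 sb [? ? ?] n0 eqn; split; [lia | lia | | lia | lia]. Qed.

Lemma feasible_swap23 p d1 d2 d3 b1 b2 b3 :
  feasible p d1 d2 d3 b1 b2 b3 -> feasible p d1 d3 d2 b1 b3 b2.
Proof. by case=> b0 sb [? ? ?] n0 eqn; split; [lia | lia | | lia | lia]. Qed.

Definition Zrange (n : Z) : seq Z := [seq Z.of_nat i | i <- iota 0 (Z.to_nat n)].

Lemma mem_Zrange (P : Z -> bool) n x : all P (Zrange n) -> 0 <= x < n -> P x.
Proof.
move=> Pn hx; move: Pn; rewrite all_map => /allP /(_ (Z.to_nat x)) /=.
rewrite Z2Nat.id; last lia.
by apply; rewrite mem_iota add0n; apply/ssrnat.ltP; lia.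
Qed.

Definition block_candidates (p : Z) : seq Z :=
  [seq b <- Zrange (p + 1) | 6 * (b * (b - 1)) mod (p - 1) =? 0].

(** The sums p - 1 and p determine d3 and b3. The conditional keeps [vm_compute] from evaluating the
    costly computations in [nat] unless the equation holds. *)
Definition check_feasible (p d1 d2 : Z) : bool :=
  let d3 := p - 1 - d1 - d2 in
  let B := block_candidates p in
  all (fun b1 => all (fun b2 =>
    let b3 := p - b1 - b2 in
    let n1 := d1 + 2 * b1 in
    let n2 := d2 + 2 * b2 in
    let n3 := d3 + 2 * b3 in
    if (p + 1) * ((d1 - b1) ^ 2 * n2 * n3 + (d2 - b2) ^ 2 * n1 * n3
                 + (d3 - b3) ^ 2 * n1 * n2) =? (2 * p - 1) * (n1 * n2 * n3)
    then [|| b3 <? 0, n1 <=? 0, n2 <=? 0, n3 <=? 0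
           | admissible (Z.to_nat p) [:: Z.to_nat n1; Z.to_nat n2; Z.to_nat n3]]
    else true) B) B.

Lemma check_feasibleP p d1 d2 d3 b1 b2 b3 :
  1 < p -> d1 + d2 + d3 = p - 1 -> check_feasible p d1 d2 ->
  feasible p d1 d2 d3 b1 b2 b3 ->
  admissible (Z.to_nat p)
    [:: Z.to_nat (d1 + 2 * b1); Z.to_nat (d2 + 2 * b2); Z.to_nat (d3 + 2 * b3)].
Proof.
move=> p1 sd chk [b0 sb [db1 db2 _] n0 eqn].
have inB b : (p - 1 | 6 * (b * (b - 1))) -> 0 <= b < p + 1 ->
    forall P, all P (block_candidates p) -> P b.
  move=> db hb P; rewrite all_filter => /mem_Zrange/(_ hb)/implyP; apply.
  by apply/Z.eqb_eq/Z.mod_divide => //; lia.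
have hb1 : 0 <= b1 < p + 1 by lia.
have hb2 : 0 <= b2 < p + 1 by lia.
move: chk => /(inB b1 db1 hb1)/(inB b2 db2 hb2); cbv beta zeta.
have -> : p - b1 - b2 = b3 by lia.
have -> : p - 1 - d1 - d2 = d3 by lia.
rewrite (proj2 (Z.eqb_eq _ _) eqn).
by case/orP=> [/Z.ltb_lt|/orP[/Z.leb_le|/orP[/Z.leb_le|/orP[/Z.leb_le|//]]]]; lia.
Qed.

(** The third term of the relation is b3^2 / (2 b3) = b3 / 2, which is less than 2, so b3 <= 3. If
    b3 is 2 or 3, its divisibility makes d divide 4 or 12; if b3 = 1, the other two divisibilities
    leave no solution. *)
Lemma feasible_unbalanced_bound p d b1 b2 b3 :
  5 <= p -> 3 * d = p - 1 -> feasible p (2 * d) d 0 b1 b2 b3 -> d <= 12.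
Proof.
move=> p5 dp [b0 sb [[w1 db1] [w2 db2] [w3 db3]] [n1 [n2 n3]]].
have d2 : 2 <= d by lia.
have {n3} b3_1 : 1 <= b3 by lia.
pose n12 := (2 * d + 2 * b1) * (d + 2 * b2).
have n12_gt0 : 0 < n12 by apply: Z.mul_pos_pos.
have n3_ge0 : 0 <= 0 + 2 * b3 by lia.
have c_gt0 : 0 < b3 * n12 by apply: Z.mul_pos_pos => //; lia.
have sq_ge0 x : 0 <= x ^ 2 by apply: Z.pow_even_nonneg; exists 1.
have N3 : 0 <= (p + 1) * ((2 * d - b1) ^ 2 * (d + 2 * b2) * (0 + 2 * b3)
                         + (d - b2) ^ 2 * (2 * d + 2 * b1) * (0 + 2 * b3)).
  apply: Z.mul_nonneg_nonneg; first lia.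
  by apply: Z.add_nonneg_nonneg; repeat apply: Z.mul_nonneg_nonneg => //; apply: Z.lt_le_incl.
move=> eqn.
have b3_lt : b3 * (p + 1) <= 2 * (2 * p - 1).
  apply: (proj2 (Z.mul_le_mono_pos_l _ _ _ c_gt0)).
  by rewrite /n12; clear -N3 eqn; lia.
move: eqn.
have {b3_lt} b3_3 : b3 <= 3 by clear -p5 b3_lt; nia.
have [b3E|[b3E|b3E]] : b3 = 1 \/ b3 = 2 \/ b3 = 3 by lia.
- have pE : p = 3 * d + 1 by lia.
  have [x Dx] : exists x, x = 2 * d - b1 by exists (2 * d - b1).
  have b1E : b1 = 2 * d - x by lia.
  have b2E : b2 = d + x by lia.
  move: db1 db2; rewrite b1E b2E b3E pE => db1 db2 eqn.
  have {eqn} eqx : x ^ 2 * (3 * d + 4) = 3 * d * (x + 3 * d).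
    by apply: (Z.mul_reg_l _ _ (18 * d)); clear -d2 eqn; lia.
  (* Modulo d, the conditions on b1 and b2 become 2(x^2 + x) = 0 and 2(x^2 - x) = 0, which differ by
     4x. *)
  have [j Dj] : exists j, 4 * x = d * j.
    by exists (w1 - w2 - 6 * d + 12 * x + 2); clear -db1 db2; lia.
  have {eqx} eqj : j ^ 2 * (3 * d + 4) = 12 * j + 144.
    have d2_neq0 : d ^ 2 <> 0 by clear -d2; nia.
    apply: (Z.mul_reg_l _ _ (d ^ 2)) => //; clear -eqx Dj.
    have -> : d ^ 2 * (j ^ 2 * (3 * d + 4)) = (d * j) ^ 2 * (3 * d + 4) by ring.
    have -> : d ^ 2 * (12 * j + 144) = 12 * d * (d * j) + 144 * d ^ 2 by ring.
    by rewrite -Dj; lia.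
  have j_lt : -6 < j < 6 by clear -eqj d2; nia.
  have : j = -5 \/ j = -4 \/ j = -3 \/ j = -2 \/ j = -1 \/ j = 0
      \/ j = 1 \/ j = 2 \/ j = 3 \/ j = 4 \/ j = 5 by clear -j_lt; lia.
  by clear -eqj; do ![case=> [jE|]; first by subst j; lia] => jE; subst j; lia.
- have dw : d * w3 = 4 by clear -dp db3 b3E; subst b3; lia.
  have w3_gt0 : 1 <= w3 by clear -d2 dw; nia.
  by clear -d2 dw w3_gt0; nia.
- have dw : d * w3 = 12 by clear -dp db3 b3E; subst b3; lia.
  have w3_gt0 : 1 <= w3 by clear -d2 dw; nia.
  by clear -d2 dw w3_gt0; nia.
Qed.

(** Put x_l = 2e - b_l, of sum -1, and let e K be the sum of the x_l^2 minus 1. The relation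
    expresses x1 x2 x3 through e and K; reduced modulo 3e + 2 it gives 3e + 2 | 4(K + 24). As 0 <= K
    <= 28, this yields 3e + 2 <= 208. *)
Lemma feasible_balanced_bound e b1 b2 b3 :
  1 <= e -> feasible (6 * e + 1) (2 * e) (2 * e) (2 * e) b1 b2 b3 ->
  e <= 68.
Proof.
move=> e1 [b0 sb [[w1 db1] [w2 db2] [w3 db3]] n0].
have [x1 Dx1] : exists x, x = 2 * e - b1 by exists (2 * e - b1).
have [x2 Dx2] : exists x, x = 2 * e - b2 by exists (2 * e - b2).
have [x3 Dx3] : exists x, x = 2 * e - b3 by exists (2 * e - b3).
have sx : x3 = - 1 - x1 - x2 by lia.
have {sb} [b1E b2E b3E] :
    [/\ b1 = 2 * e - x1, b2 = 2 * e - x2 & b3 = 2 * e - x3] by split; lia.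
have y1_lim : 0 < 3 * e - x1 <= 7 * e + 1 by lia.
have y2_lim : 0 < 3 * e - x2 <= 7 * e + 1 by lia.
have y3_lim : 0 < 3 * e - x3 <= 7 * e + 1 by lia.
subst b1 b2 b3; clear b0 n0 Dx1 Dx2 Dx3.
(* Modulo e, b(b - 1) is x^2 + x; now sum over the three indices. *)
have [K DK] : exists K, e * K = x1 ^ 2 + x2 ^ 2 + x3 ^ 2 - 1.
  exists (w1 + w2 + w3 - (4 * e - 4 * x1 - 2) - (4 * e - 4 * x2 - 2) - (4 * e - 4 * x3 - 2)).
  by clear -db1 db2 db3 sx; lia.
clear db1 db2 db3 => eqn.
have {eqn} eqn : (3 * e + 1) * (x1 ^ 2 * (3 * e - x2) * (3 * e - x3)
     + x2 ^ 2 * (3 * e - x1) * (3 * e - x3) + x3 ^ 2 * (3 * e - x1) * (3 * e - x2))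
     = (12 * e + 1) * ((3 * e - x1) * (3 * e - x2) * (3 * e - x3)).
  have H x : 2 * e + 2 * (2 * e - x) = 2 * (3 * e - x) by ring.
  have H' x : 2 * e - (2 * e - x) = x by ring.
  move: eqn; rewrite !{}H !{}H'; clear.
  by move: (3 * e - x1) (3 * e - x2) (3 * e - x3) => y1 y2 y3; lia.
(* With f = (X - x1) (X - x2) (X - x3), the sum of x^2 / (3 e - x) over the     *)
(* roots is 1 - 9 e + 9 e^2 f'(3 e) / f(3 e), and 2 f'(3 e) involves only e K.  *)
have eqF : e * (3 * e + 1) * (54 * e ^ 2 + 12 * e - e * K)
         = 2 * (3 * e + 2) * ((3 * e - x1) * (3 * e - x2) * (3 * e - x3)).
  apply: (Z.mul_reg_l _ _ (9 * e)); first by clear -e1; lia.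
  by rewrite DK; clear -eqn sx; subst x3; lia.
have eqS : 2 * (3 * e + 2) * (x1 * x2 * x3) = e ^ 2 * (72 * e + 24 - K * (6 * e + 5)).
  have E1 : 2 * (x1 * x2 + x2 * x3 + x3 * x1) = - (e * K).
    by clear -DK sx; subst x3; lia.
  have -> : x1 * x2 * x3 = 27 * e ^ 3 + 9 * e ^ 2 + 3 * e * (x1 * x2 + x2 * x3 + x3 * x1)
       - (3 * e - x1) * (3 * e - x2) * (3 * e - x3).
    by clear -sx; subst x3; lia.
  have {E1} E2 : 3 * e * (3 * e + 2) * (2 * (x1 * x2 + x2 * x3 + x3 * x1))
               = 3 * e * (3 * e + 2) * - (e * K) by rewrite E1.
  move: eqF E2; clear; move: (x1 * x2 + x2 * x3 + x3 * x1) => S2.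
  by move: ((3 * e - x1) * (3 * e - x2) * (3 * e - x3)) => f; lia.
(* 9 e^2 = 4 modulo 3 e + 2 *)
have dvK : (3 * e + 2 | 4 * (K + 24)).
  exists ((3 * e - 2) * (72 * e + 24 - K * (6 * e + 5)) + 96 - 8 * K - 18 * (x1 * x2 * x3)).
  by clear -eqS; lia.
have K_ge : 0 <= K.
  have : 1 <= x1 ^ 2 + x2 ^ 2 + x3 ^ 2 by clear -sx; nia.
  by clear -DK e1; nia.
(* As 3e - x_l <= 7e + 1, the sum of the x_l^2 is at most 7e + 1 times the sum of the x_l^2 / (3e -
   x_l), which is (12e + 1) / (3e + 1). *)
have K_le : K <= 28.
  have [y1 [Dy1 y1_gt0]] : exists y, 3 * e - x1 = y /\ 0 < y <= 7 * e + 1.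
    by exists (3 * e - x1).
  have [y2 [Dy2 y2_gt0]] : exists y, 3 * e - x2 = y /\ 0 < y <= 7 * e + 1.
    by exists (3 * e - x2).
  have [y3 [Dy3 y3_gt0]] : exists y, 3 * e - x3 = y /\ 0 < y <= 7 * e + 1.
    by exists (3 * e - x3).
  rewrite Dy1 Dy2 Dy3 in eqn.
  have lim x y z t : 0 < y -> 0 < z -> 0 < t <= 7 * e + 1 ->
      0 <= x ^ 2 * y * z * (7 * e + 1 - t).
    have := Z.pow_even_nonneg x 2 ltac:(by exists 1).
    by move: (x ^ 2) => q q0 y0 z0 t0; repeat apply: Z.mul_nonneg_nonneg; lia.
  have l1 := lim x1 y2 y3 y1 (proj1 y2_gt0) (proj1 y3_gt0) y1_gt0.
  have l2 := lim x2 y1 y3 y2 (proj1 y1_gt0) (proj1 y3_gt0) y2_gt0.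
  have l3 := lim x3 y1 y2 y3 (proj1 y1_gt0) (proj1 y2_gt0) y3_gt0.
  have P_gt0 : 0 < y1 * y2 * y3 by repeat apply: Z.mul_pos_pos; lia.
  have : (3 * e + 1) * (e * K + 1) <= (12 * e + 1) * (7 * e + 1).
    apply: (proj2 (Z.mul_le_mono_pos_l _ _ _ P_gt0)).
    have -> : y1 * y2 * y3 * ((12 * e + 1) * (7 * e + 1))
            = (12 * e + 1) * (y1 * y2 * y3) * (7 * e + 1) by ring.
    rewrite -eqn (_ : e * K + 1 = x1 ^ 2 + x2 ^ 2 + x3 ^ 2); last by clear -DK; lia.
    have L := Z.add_nonneg_nonneg _ _ (Z.add_nonneg_nonneg _ _ l1 l2) l3.
    have {L} := Z.mul_nonneg_nonneg (3 * e + 1) _ ltac:(lia) L.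
    by clear; lia.
  by clear -e1; nia.
have := Z.divide_pos_le _ _ _ dvK; clear -K_ge K_le e1; lia.
Qed.

Lemma check_unbalanced :
  all (fun d => (1 <? d) ==> check_feasible (3 * d + 1) (2 * d) d) (Zrange 13).
Proof. by vm_compute. Qed.

Lemma check_balanced :
  all (fun e => (0 <? e) ==> check_feasible (6 * e + 1) (2 * e) (2 * e)) (Zrange 69).
Proof. by vm_compute. Qed.

(** With s = b2 + b3 the relation is (s - 1)^2 / n1 + s / 2 = (2p - 1) / (p + 1) < 2, so s is 2 or
    3. The value 2 is impossible for p >= 5; the value 3 forces p = 9, and 8 does not divide 12. *)
Lemma feasible_concentrated_false p b1 b2 b3 :
  5 <= p -> ~ feasible p (p - 1) 0 0 b1 b2 b3.
Proof.
move=> p5 [b0 sb [_ [w2 db2] [w3 db3]] [n1 [n2 n3]]].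
have b2_gt0 : 0 < b2 by lia.
have b3_gt0 : 0 < b3 by lia.
have -> : b1 = p - b2 - b3 by lia.
rewrite (_ : p - 1 + 2 * (p - b2 - b3) = 3 * p - 1 - 2 * (b2 + b3)) ; last lia.
have {n1} n1 : 0 < 3 * p - 1 - 2 * (b2 + b3) by lia.
move=> eqn.
have : (p + 1) * (2 * (b2 + b3 - 1) ^ 2 + (b2 + b3) * (3 * p - 1 - 2 * (b2 + b3)))
     = 2 * (2 * p - 1) * (3 * p - 1 - 2 * (b2 + b3)).
  apply: (Z.mul_reg_l _ _ (2 * b2 * b3)); first by clear -b2_gt0 b3_gt0; nia.
  by clear -eqn; lia.
move=> {}eqn.
have s2 : 2 <= b2 + b3 by lia.
have s4 : b2 + b3 < 4.
  clear -p5 n1 s2 eqn; move: (b2 + b3) n1 s2 eqn => s n1 s2 eqn.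
  have sq0 : 0 <= 2 * (p + 1) * (s - 1) ^ 2 by nia.
  by nia.
have [sE|sE] : b2 + b3 = 2 \/ b2 + b3 = 3 by lia.
  by rewrite sE in eqn; clear -p5 eqn; nia.
have p9 : p = 9.
  have /Z.mul_eq_0 : (p - 9) * (p - 1) = 0 by rewrite sE in eqn; clear -eqn; lia.
  by clear -p5; lia.
have [b2E|b2E] : b2 = 1 \/ b2 = 2 by lia.
  have b3E : b3 = 2 by lia.
  by clear -db3 b3E p9; subst; lia.
by clear -db2 b2E p9; subst; lia.
Qed.

(** The t_l form a partition of 3. Oddness of p makes 6 divide p - 1 in the case (1,1,1). *)
Lemma sorted_feasible_admissible p k d1 d2 d3 b1 b2 b3 t1 t2 t3 :
  5 <= p -> p = 2 * k + 1 ->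
  [/\ 3 * d1 = (p - 1) * t1, 3 * d2 = (p - 1) * t2 & 3 * d3 = (p - 1) * t3] ->
  [/\ t1 + t2 + t3 = 3, 0 <= t3, t3 <= t2 & t2 <= t1] ->
  feasible p d1 d2 d3 b1 b2 b3 ->
  admissible (Z.to_nat p)
    [:: Z.to_nat (d1 + 2 * b1); Z.to_nat (d2 + 2 * b2); Z.to_nat (d3 + 2 * b3)].
Proof.
move=> p5 p_odd [dt1 dt2 dt3] [st t0 t32 t21] F.
have : (t1 = 1 /\ t2 = 1 /\ t3 = 1) \/ (t1 = 2 /\ t2 = 1 /\ t3 = 0)
   \/ (t1 = 3 /\ t2 = 0 /\ t3 = 0) by clear -st t0 t32 t21; lia.
clear st t0 t32 t21; case=> [|[|]] [? [? ?]]; subst t1 t2 t3.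
- have [e eE] : exists e, p - 1 = 6 * e.
    by exists (k - d1); clear -dt1 p_odd; lia.
  have [d1E [d2E d3E]] : d1 = 2 * e /\ d2 = 2 * e /\ d3 = 2 * e.
    by clear -dt1 dt2 dt3 eE; lia.
  have pE : p = 6 * e + 1 by clear -eE; lia.
  clear -p5 d1E d2E d3E pE F; subst.
  have e1 : 1 <= e by clear -p5; lia.
  have e_lim : 0 <= e < 69 by split; [|have := feasible_balanced_bound e1 F]; clear -e1; lia.
  apply: check_feasibleP F; try by clear -p5; lia.
  by have /implyP := mem_Zrange check_balanced e_lim; apply; apply/Z.ltb_lt; clear -e1; lia.
- have [d1E d3E] : d1 = 2 * d2 /\ d3 = 0.
    by clear -dt1 dt2 dt3; lia.
  have d2E : 3 * d2 = p - 1.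
    by clear -dt1 dt2 dt3; lia.
  clear -p5 d1E d2E d3E F; subst d1 d3.
  apply: (check_feasibleP _ _ _ F); try by clear -p5 d2E; lia.
  have d2_gt1 : 1 < d2 by clear -p5 d2E; lia.
  have d2_lim : 0 <= d2 < 13.
    by have := feasible_unbalanced_bound p5 d2E F; clear -d2_gt1; lia.
  have -> : p = 3 * d2 + 1 by clear -d2E; lia.
  by have /implyP := mem_Zrange check_unbalanced d2_lim; apply; apply/Z.ltb_lt.
- have [d1E [d2E d3E]] : d1 = p - 1 /\ d2 = 0 /\ d3 = 0.
    by clear -dt1 dt2 dt3; lia.
  by subst; case: (feasible_concentrated_false p5 F).
Qed.

Lemma feasible_admissible p k d1 d2 d3 b1 b2 b3 :
  5 <= p -> p = 2 * k + 1 ->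
  [/\ 0 <= d1, 0 <= d2, 0 <= d3 & d1 + d2 + d3 = p - 1] ->
  [/\ (p - 1 | 3 * d1), (p - 1 | 3 * d2) & (p - 1 | 3 * d3)] ->
  feasible p d1 d2 d3 b1 b2 b3 ->
  admissible (Z.to_nat p)
    [:: Z.to_nat (d1 + 2 * b1); Z.to_nat (d2 + 2 * b2); Z.to_nat (d3 + 2 * b3)].
Proof.
move=> p5 p_odd [d1_ge0 d2_ge0 d3_ge0 sd] [[t1 dt1] [t2 dt2] [t3 dt3]].
have t1_ge0 : 0 <= t1 by clear -dt1 d1_ge0 p5; nia.
have t2_ge0 : 0 <= t2 by clear -dt2 d2_ge0 p5; nia.
have t3_ge0 : 0 <= t3 by clear -dt3 d3_ge0 p5; nia.
have st : t1 + t2 + t3 = 3 by clear -dt1 dt2 dt3 sd p5; nia.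
have {}dt1 : 3 * d1 = (p - 1) * t1 by rewrite dt1 Z.mul_comm.
have {}dt2 : 3 * d2 = (p - 1) * t2 by rewrite dt2 Z.mul_comm.
have {}dt3 : 3 * d3 = (p - 1) * t3 by rewrite dt3 Z.mul_comm.
have p12 (x y z : nat) : perm_eq [:: x; y; z] [:: y; x; z].
  exact: permEl (perm_catCA [:: x] [:: y] [:: z]).
have p23 (x y z : nat) : perm_eq [:: x; y; z] [:: x; z; y].
  by rewrite perm_cons; exact: permEl (perm_catC [:: y] [:: z]).
have sortP := sorted_feasible_admissible p5 p_odd.
have sw12 x y z : admissible (Z.to_nat p) [:: x; y; z] = admissible (Z.to_nat p) [:: y; x; z].
  exact: admissible_perm (p12 _ _ _).
have sw23 x y z : admissible (Z.to_nat p) [:: x; y; z] = admissible (Z.to_nat p) [:: x; z; y].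
  exact: admissible_perm (p23 _ _ _).
have [t12|t12] : t2 <= t1 \/ t1 <= t2 by lia.
all: have [t23|t23] : t3 <= t2 \/ t2 <= t3 by lia.
all: have [t13|t13] : t3 <= t1 \/ t1 <= t3 by lia.
all: move=> F.
all: first
  [ by apply: (sortP _ _ _ _ _ _ t1 t2 t3) => //; split=> //; lia
  | by rewrite sw23; apply: (sortP _ _ _ _ _ _ t1 t3 t2);
      [split | split=> //; lia | apply: feasible_swap23]
  | by rewrite sw12; apply: (sortP _ _ _ _ _ _ t2 t1 t3);
      [split | split=> //; lia | apply: feasible_swap12]
  | by rewrite sw12 sw23; apply: (sortP _ _ _ _ _ _ t2 t3 t1);
      [split | split=> //; lia | apply/feasible_swap23/feasible_swap12]
  | by rewrite sw23 sw12; apply: (sortP _ _ _ _ _ _ t3 t1 t2);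
      [split | split=> //; lia | apply/feasible_swap12/feasible_swap23]
  | by rewrite sw12 sw23 sw12; apply: (sortP _ _ _ _ _ _ t3 t2 t1);
      [split | split=> //; lia
             | apply/feasible_swap12/feasible_swap23/feasible_swap12]].
Qed.

End Arithmetic.

(* Importing zify earlier makes nia diverge on the nonlinear goals above.      *)
From mathcomp Require Import zify ssrZ ring.

Import GroupScope GRing.Theory Num.Theory.
Local Open Scope ring_scope.

(** * Matrices indexed by points, and the idempotents of the irreducible characters *)

Section PermutationModule.

Variables (T : finType) (G : {group {perm T}}).
Implicit Types (a b c : T) (g h : {perm T}) (M N : 'M[algC]_#|T|).

Definition kernel_mx (F : T -> T -> algC) : 'M[algC]_#|T| :=
  \matrix_(i, j) F (enum_val i) (enum_val j).

Definition entry M a b := M (enum_rank a) (enum_rank b).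

Lemma entry_kernel F a b : entry (kernel_mx F) a b = F a b.
Proof. by rewrite /entry mxE !enum_rankK. Qed.

Lemma entryP M N : (forall a b, entry M a b = entry N a b) -> M = N.
Proof.
by move=> eqMN; apply/matrixP=> i j; have := eqMN (enum_val i) (enum_val j);
  rewrite /entry !enum_valK.
Qed.

Lemma entry_mul M N a b : entry (M *m N) a b = \sum_c entry M a c * entry N c b.
Proof.
rewrite /entry mxE (reindex (@enum_val _ T)) /=; last exact: onW_bij (enum_val_bij _).
by apply: eq_bigr => i _; rewrite enum_valK.
Qed.

Lemma trace_entry M : \tr M = \sum_a entry M a a.
Proof.
rewrite /mxtrace (reindex (@enum_rank T)) /=; last exact: onW_bij (enum_rank_bij _).
by [].
Qed.

Lemma entryZ x M a b : entry (x *: M) a b = x * entry M a b.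
Proof. exact: mxE. Qed.

Lemma entryD M N a b : entry (M + N) a b = entry M a b + entry N a b.
Proof. exact: mxE. Qed.

Lemma entryB M N a b : entry (M - N) a b = entry M a b - entry N a b.
Proof. by rewrite /entry !mxE. Qed.

Lemma entry_sum I (r : seq I) (P : pred I) (F : I -> 'M_#|T|) a b :
  entry (\sum_(i <- r | P i) F i) a b = \sum_(i <- r | P i) entry (F i) a b.
Proof. exact: summxE. Qed.

Lemma entry1 a b : entry 1%:M a b = (a == b)%:R.
Proof. by rewrite /entry mxE (inj_eq enum_rank_inj). Qed.

Definition act_mx g : 'M[algC]_#|T| := kernel_mx (fun a b => (g a == b)%:R).

Lemma entry_act_mx g a b : entry (act_mx g) a b = (g a == b)%:R.
Proof. exact: entry_kernel. Qed.

Lemma entry_act_mull g M a b : entry (act_mx g *m M) a b = entry M (g a) b.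
Proof.
rewrite entry_mul (bigD1 (g a)) //= entry_act_mx eqxx mul1r big1 ?addr0 // => c.
by rewrite eq_sym entry_act_mx => /negPf->; rewrite mul0r.
Qed.

Lemma entry_act_mulr g M a b : entry (M *m act_mx g) a b = entry M a (g^-1%g b).
Proof.
rewrite entry_mul (bigD1 (g^-1%g b)) //= entry_act_mx permKV eqxx mulr1.
rewrite big1 ?addr0 // => c ne_c.
by rewrite entry_act_mx (can2_eq (permK g) (permKV g)) (negPf ne_c) mulr0.
Qed.

Lemma act_mxM g h : act_mx (g * h)%g = act_mx g *m act_mx h.
Proof.
by apply: entryP => a b; rewrite entry_act_mull !entry_act_mx permM.
Qed.

Lemma trace_act_mx g : \tr (act_mx g) = #|'Fix_'P[g]|%:R.
Proof.
rewrite trace_entry -sum1_card natr_sum [RHS]big_mkcond /=; apply: eq_bigr => a _.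
rewrite entry_act_mx (sameP afix1P eqP) /= apermE.
by case: (_ == _).
Qed.

Definition mx_invariant M := forall g a b, g \in G -> entry M (g a) (g b) = entry M a b.

(** The action on the permutation module of the central idempotent of the group algebra attached to
    ['chi_i]. *)
Definition idem_mx (i : Iirr G) : 'M[algC]_#|T| :=
  ('chi_i 1%g / #|G|%:R) *: \sum_(g in G) 'chi_i g^-1%g *: act_mx g.

Local Notation E := idem_mx.

(** The coefficient of [act_mx g] in the product is a convolution of two irreducible characters,
    evaluated by the generalized orthogonality relation. *)
Lemma idem_mxM i j : E i *m E j = (i == j)%:R *: E i.
Proof.
rewrite /idem_mx -scalemxAl -scalemxAr mulmx_suml.
transitivity (('chi_i 1%g / #|G|%:R * ('chi_j 1%g / #|G|%:R)) *:
   \sum_(g in G) (\sum_(h in G) 'chi_j (h * g^-1)%g * 'chi_i h^-1%g) *: act_mx g).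
  rewrite scalerA; congr (_ *: _); under [RHS]eq_bigr do rewrite scaler_suml.
  rewrite [RHS]exchange_big; apply: eq_bigr => h Gh /=.
  rewrite mulmx_sumr (reindex_inj (mulgI h^-1%g)) /=.
  apply: eq_big => [g | g]; first by rewrite groupMl ?groupV.
  rewrite groupMl ?groupV // => Gg.
  rewrite -scalemxAl -scalemxAr scalerA -act_mxM mulKVg invMg invgK [in RHS]mulrC.
  congr (_ * _ *: _); rewrite -[RHS](cfunJ _ _ Gh) ?groupM ?groupV //.
  by rewrite conjgE !mulgA mulVg mul1g.
rewrite scaler_sumr [in RHS]scalerA scaler_sumr; apply: eq_bigr => g Gg.
rewrite !scalerA; congr (_ *: _).
have := generalized_orthogonality_relation g^-1%g j i.
move/(canRL (mulVKf (neq0CG G)))=> ->.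
case: (eqVneq i j) => [-> | _]; last by rewrite !(mul0r, mulr0).
rewrite !mul1r; by field; rewrite ?irr1_neq0 ?neq0CG.
Qed.

Lemma idem_mx_adj i a b : entry (E i) b a = (entry (E i) a b)^*.
Proof.
rewrite /idem_mx !entryZ !entry_sum rmorphM rmorph_sum /= fmorph_div /= rmorph_nat.
rewrite (conj_natr (Cnat_irr1 i)) (reindex_inj invg_inj) /=; congr (_ * _).
apply: eq_big => g; first by rewrite groupV.
rewrite groupV => Gg; rewrite !entryZ rmorphM !entry_act_mx rmorph_nat invgK irr_inv /= conjCK.
by rewrite (can2_eq (permKV g) (permK g)) eq_sym.
Qed.

Lemma idem_mx_invariant i : mx_invariant (E i).
Proof.
move=> h a b Gh; rewrite /idem_mx !entryZ !entry_sum; congr (_ * _).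
rewrite [RHS](reindex_inj (conjg_inj h^-1%g)) /=.
apply: eq_big => g; first by rewrite groupJr ?groupV.
move=> Gg; rewrite !entryZ !entry_act_mx -conjVg cfunJ ?groupV //.
by rewrite conjgE invgK !permM -(inj_eq (@perm_inj _ h) _ b) permKV.
Qed.

Section MultiplicityFree.
Variable K : {set Iirr G}.
Hypothesis piE : perm_char G = \sum_(k in K) 'chi_k.

(** Traces of permutation matrices are values of the permutation character; orthogonality then
    selects its constituent [i], if present. *)
Lemma trace_idem_act i h : h \in G -> \tr (E i *m act_mx h) = (i \in K)%:R * 'chi_i h.
Proof.
move=> Gh; rewrite /idem_mx -scalemxAl mulmx_suml linearZ linear_sum /=.
transitivity ('chi_i 1%g / #|G|%:R
    * \sum_(k in K) \sum_(g in G) 'chi_k (g * h)%g * 'chi_i g^-1%g).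
  congr (_ * _); rewrite [RHS]exchange_big; apply: eq_bigr => g Gg /=.
  rewrite -scalemxAl -act_mxM linearZ /= trace_act_mx -(perm_charE (groupM Gg Gh)) piE.
  by rewrite sum_cfunE mulr_sumr; apply: eq_bigr => k _; rewrite mulrC.
rewrite (eq_bigr (fun k => #|G|%:R * ((k == i)%:R * ('chi_k h / 'chi_k 1%g)))); last first.
  by move=> k _; rewrite -generalized_orthogonality_relation mulVKf ?neq0CG.
rewrite big_mkcond (bigD1 i) //= big1 ?addr0 => [|k /negPf->]; last first.
  by rewrite mul0r mulr0; case: ifP.
case: ifP => _; rewrite ?mulr0 ?mul0r // eqxx !mul1r.
by field; rewrite ?irr1_neq0 ?neq0CG.
Qed.

Lemma trace_idem i : i \in K -> \tr (E i) = 'chi_i 1%g.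
Proof.
move=> Ki; have := trace_idem_act i (group1 G); rewrite Ki mul1r => <-.
congr (\tr _); apply: entryP => a b; rewrite entry_act_mulr invg1 perm1 //.
Qed.

Hypothesis transG : [transitive G, on [set: T] | 'P].

Lemma transG_exists a b : exists2 g, g \in G & g a = b.
Proof.
by have [g Gg ->] := atransP2 transG (in_setT a) (in_setT b); exists g.
Qed.

Lemma entry_diag M a : mx_invariant M -> entry M a a = \tr M / #|T|%:R.
Proof.
move=> invM; have nT : #|T|%:R != 0 :> algC.
  by rewrite pnatr_eq0 -lt0n; apply/card_gt0P; exists a.
apply: canRL (mulfK nT) _; rewrite trace_entry mulr_natr -sumr_const.
apply: eq_bigr => b _; have [g Gg <-] := transG_exists a b.
by rewrite invM.
Qed.

Lemma idem_mx_diag i a : i \in K -> entry (E i) a a = 'chi_i 1%g / #|T|%:R.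
Proof. by move=> Ki; rewrite entry_diag ?trace_idem //; apply: idem_mx_invariant. Qed.

Local Notation suborbits a := (orbit 'P 'C_G[a | 'P] @: [set: T]).

End MultiplicityFree.
End PermutationModule.

(** * The rank, and the span of the idempotents *)

Section Commutant.

Variables (T : finType) (G : {group {perm T}}).
Implicit Types (a b c : T) (g h : {perm T}) (M N : 'M[algC]_#|T|).
Local Notation E := (@idem_mx T G).
Variable K : {set Iirr G}.
Hypothesis piE : perm_char G = \sum_(k in K) 'chi_k.
Hypothesis transG : [transitive G, on [set: T] | 'P].
Local Notation suborbits a := (orbit 'P 'C_G[a | 'P] @: [set: T]).

Lemma sum_fix_sqr : (\sum_(g in G) #|'Fix_'P[g]| ^ 2 = #|K| * #|G|)%N.
Proof.
apply/eqP; rewrite -(eqr_nat algC) natrM natr_sum; apply/eqP.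
have : '[perm_char G] = #|K|%:R :> algC.
  rewrite {2}piE cfdot_sumr -sum1_card natr_sum; apply: eq_bigr => k Kk.
  rewrite piE cfdot_suml (bigD1 k) //= cfdot_irr eqxx big1 ?addr0 // => j /andP[_ ne].
  by rewrite cfdot_irr (negPf ne).
rewrite cfdotE => /(canRL (mulVKf (neq0CG G))); rewrite mulrC => <-.
apply: eq_bigr => g Gg; rewrite perm_charE // natrX expr2.
by rewrite conj_natr ?natr_nat.
Qed.

Lemma acts_setT (H : {group {perm T}}) : [acts H, on [set: T] | 'P].
Proof. by apply/actsP=> g _ a; rewrite !inE. Qed.

Lemma sum_fix_orbits (H : {group {perm T}}) :
  (\sum_(g in H) #|'Fix_'P[g]| = #|orbit 'P H @: [set: T]| * #|H|)%N.
Proof.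
rewrite -Frobenius_Cauchy ?acts_setT //; apply: eq_bigr => g _.
by rewrite setTI.
Qed.

Lemma in_point_stab a g : (g \in 'C_G[a | 'P]) = (g \in G) && (g a == a).
Proof. by rewrite in_setI (sameP astab1P eqP) /= apermE. Qed.

(** Both sides times |G| count the squared fixed-point numbers: by the norm of the permutation
    character, and by summing over fixed points b and applying Cauchy-Frobenius to each stabiliser,
    all of these being conjugate. *)
Lemma card_suborbits a : #|suborbits a| = #|K|.
Proof.
have sumC b : (\sum_(g in 'C_G[b | 'P]) #|'Fix_'P[g]| =
               \sum_(g in 'C_G[a | 'P]) #|'Fix_'P[g]|)%N.
  have [h Gh <-] := transG_exists transG a b.
  rewrite (reindex_inj (conjg_inj h)) /=; apply: eq_big => [g | g].
    by rewrite !in_point_stab groupJr // conjgE !permM permK (inj_eq perm_inj).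
  rewrite in_point_stab groupJr // => /andP[Gg _].
  apply/eqP; rewrite -(eqr_nat algC); apply/eqP.
  by rewrite -(perm_charE Gg) -(perm_charE (groupJ Gg Gh)) cfunJ.
have := sum_fix_sqr.
rewrite (eq_bigr (fun g => \sum_(b in 'Fix_'P[g]) #|'Fix_'P[g]|)%N); last first.
  by move=> g _; rewrite sum_nat_const.
rewrite (exchange_big_dep predT) //=.
rewrite (eq_bigr (fun b => \sum_(g in 'C_G[a | 'P]) #|'Fix_'P[g]|)%N); last first.
  move=> b _; rewrite -(sumC b); apply: eq_bigl => g.
  by rewrite in_point_stab (sameP afix1P eqP) /= apermE.
rewrite sum_nat_const sum_fix_orbits -(card_orbit_stab 'P%act G a).
rewrite (atransP transG) ?inE // cardsT [in RHS]mulnCA => /eqP.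
rewrite eqn_pmul2l; last by apply/card_gt0P; exists a.
by rewrite eqn_pmul2r // => /eqP.
Qed.

(** The default [a] is never reached on an orbit, which is nonempty. *)
Definition suborbit_repr a (X : {set T}) := odflt a [pick x in X].

Lemma suborbit_repr_mem a b :
  suborbit_repr a (orbit 'P 'C_G[a | 'P] b) \in orbit 'P 'C_G[a | 'P] b.
Proof.
rewrite /suborbit_repr; case: pickP => //= /(_ b).
by rewrite orbit_refl.
Qed.

Lemma entry_suborbit M a b c :
  mx_invariant G M -> c \in orbit 'P 'C_G[a | 'P] b -> entry M a c = entry M a b.
Proof.
move=> invM /orbitP[g /setIP[Gg /astab1P Cg] <-].
by rewrite -{1}Cg /= !apermE invM.
Qed.

Lemma invariant_eq0 M a :
  mx_invariant G M -> (forall b, entry M a b = 0) -> M = 0.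
Proof.
move=> invM Ma0; apply: entryP => b c; rewrite [RHS]mxE.
by have [g Gg <-] := transG_exists transG a b; rewrite -(permKV g c) invM.
Qed.

Lemma invariant_comb (c : Iirr G -> algC) : mx_invariant G (\sum_(k in K) c k *: E k).
Proof.
move=> g a b Gg; rewrite !entry_sum; apply: eq_bigr => k _.
by rewrite !(entryZ (c k)) (idem_mx_invariant k) //.
Qed.

Lemma comb_mul_idem (c : Iirr G -> algC) i :
  i \in K -> (\sum_(k in K) c k *: E k) *m E i = c i *: E i.
Proof.
move=> Ki; rewrite mulmx_suml (bigD1 i) //= big1 => [|k /andP[_ ne]].
  by rewrite -scalemxAl idem_mxM eqxx scale1r addr0.
by rewrite -scalemxAl idem_mxM (negPf ne) scale0r scaler0.
Qed.

Lemma idem_comb_mul (c : Iirr G -> algC) i :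
  i \in K -> E i *m (\sum_(k in K) c k *: E k) = c i *: E i.
Proof.
move=> Ki; rewrite mulmx_sumr (bigD1 i) //= big1 => [|k /andP[_ ne]].
  by rewrite -scalemxAr idem_mxM eqxx scale1r addr0.
by rewrite -scalemxAr idem_mxM eq_sym (negPf ne) scale0r scaler0.
Qed.

Lemma idem_mx_neq0 i : i \in K -> E i != 0.
Proof.
move=> Ki; apply: contraNneq (irr1_neq0 i) => E0.
by rewrite -(trace_idem piE Ki) E0 mxtrace0.
Qed.

(** An invariant matrix is determined by its row at [a], hence by its entries at suborbit
    representatives. The idempotents are independent and as many as the suborbits, so some
    combination agrees with [M] on that row. *)
Lemma invariant_span M a :
  mx_invariant G M -> exists c : Iirr G -> algC, M = \sum_(k in K) c k *: E k.
Proof.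
move=> invM; pose S := suborbits a.
pose rowS N : 'rV_#|S| := \row_v entry N a (suborbit_repr a (enum_val v)).
have rowS_inj N : mx_invariant G N -> rowS N = 0 -> N = 0.
  move=> invN /rowP N0; apply: (invariant_eq0 (a := a)) => // b.
  have Sb : orbit 'P 'C_G[a | 'P] b \in S by apply: imset_f; rewrite inE.
  have := N0 (enum_rank_in Sb (orbit 'P 'C_G[a | 'P] b)).
  rewrite !mxE enum_rankK_in // => <-; apply/esym/entry_suborbit => //.
  exact: suborbit_repr_mem.
pose comb (v : 'rV[algC]_#|K|) := \sum_u v 0 u *: E (enum_val u).
pose cf (v : 'rV[algC]_#|K|) k := \sum_u v 0 u * (enum_val u == k)%:R.
have combE v : comb v = \sum_(k in K) cf v k *: E k.
  rewrite /comb; under [RHS]eq_bigr do rewrite scaler_suml.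
  rewrite exchange_big; apply: eq_bigr => u _ /=.
  rewrite (bigD1 (enum_val u)) ?enum_valP //= eqxx mulr1 big1 ?addr0 // => k /andP[_ ne].
  by rewrite eq_sym (negPf ne) mulr0 scale0r.
pose Q : 'M_(#|K|, #|S|) := \matrix_u rowS (E (enum_val u)).
have mulQ v : v *m Q = rowS (comb v).
  apply/rowP=> w; rewrite !mxE entry_sum; apply: eq_bigr => u _.
  by rewrite entryZ !mxE.
have inv_comb v : mx_invariant G (comb v) by rewrite combE; apply: invariant_comb.
have freeQ : row_free Q.
  apply: inj_row_free => v; rewrite mulQ => /(rowS_inj _ (inv_comb v)) v0.
  apply/rowP=> u; rewrite mxE; have Ku := enum_valP u.
  have := comb_mul_idem (cf v) Ku; rewrite -combE v0 mul0mx => /esym/eqP.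
  rewrite scaler_eq0 (negPf (idem_mx_neq0 Ku)) orbF => /eqP.
  rewrite /cf (bigD1 u) //= eqxx mulr1 big1 ?addr0 // => w ne.
  by rewrite (inj_eq enum_val_inj) (negPf ne) mulr0.
have fullQ : row_full Q by rewrite /row_full (eqP freeQ) -(card_suborbits a).
exists (cf (rowS M *m pinvmx Q)); rewrite -combE.
apply/eqP; rewrite -subr_eq0; apply/eqP/rowS_inj.
  by move=> g b c Gg; rewrite !entryB invM // (inv_comb _).
have /rowP D := mulmxKpV (submx_full (rowS M) fullQ).
apply/rowP=> w; have := D w; rewrite mulQ !mxE entryB => ->.
by rewrite subrr.
Qed.

End Commutant.

(** * A semiregular element of order p *)

Section SemiregularElement.

Variables (T : finType) (G : {group {perm T}}) (p : nat).
Hypotheses (p_prime : prime p) (p_ge5 : (5 <= p)%N) (degG : #|T| = (3 * p)%N).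
Hypothesis transG : [transitive G, on [set: T] | 'P].

(** Since 3 is prime to p, |P| is p times the p-part of the order of the point stabiliser, and the
    order of the stabiliser in P divides that p-part. *)
Lemma Sylow_orbit_dvd (P : {group {perm T}}) a :
  p.-Sylow(G) P -> (p %| #|orbit 'P P a|)%N.
Proof.
move=> sylP; have sPG := pHall_sub sylP; have pP := pHall_pgroup sylP.
have cardG : (#|G| = (3 * p) * #|'C_G[a | 'P]|)%N.
  by rewrite -(card_orbit_stab 'P%act G a) (atransP transG) ?inE // cardsT degG.
have cardP : (#|P| = p * #|'C_G[a | 'P]|`_p)%N.
  have p_gt0 := prime_gt0 p_prime.
  have p'3 : p^'.-nat 3 by rewrite p'natE // gtnNdvd // (leq_trans _ p_ge5).
  rewrite (card_Hall sylP) cardG !partnM ?muln_gt0 ?p_gt0 ?cardG_gt0 //.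
  by rewrite (part_p'nat p'3) mul1n part_pnat_id ?pnat_id.
have : (#|'C_P[a | 'P]| %| #|'C_G[a | 'P]|`_p)%N.
  have pC : p.-group 'C_P[a | 'P] by apply: pgroupS pP; apply: subsetIl.
  rewrite -(part_pnat_id pC) partn_dvd // cardSg //.
  by apply: setSI.
case/dvdnP=> m Dm; apply/dvdnP; exists m; apply/eqP.
rewrite -(eqn_pmul2r (cardG_gt0 'C_P[a | 'P])) card_orbit_stab cardP Dm.
by rewrite mulnCA mulnA.
Qed.

(* By Cauchy-Frobenius the elements of a Sylow p-subgroup have at most 3 fixed  *)
(* points on average, while each number of fixed points is a multiple of p > 3. *)
Lemma exists_semiregular :
  exists2 x, x \in G & #[x] = p /\ forall h a, h \in <[x]> -> h a = a -> h = 1%g.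
Proof.
have [P sylP] := Sylow_exists p G.
have sPG := pHall_sub sylP; have pP := pHall_pgroup sylP.
have p_gt0 := prime_gt0 p_prime.
have orb3 : (#|orbit 'P P @: [set: T]| <= 3)%N.
  have : (#|orbit 'P P @: [set: T]| * p <= #|T|)%N.
    rewrite -cardsT (card_partition (orbit_partition (acts_setT P))) -sum_nat_const.
    apply: leq_sum => _ /imsetP[a _ ->]; rewrite dvdn_leq ?Sylow_orbit_dvd //.
    by apply/card_gt0P; exists a; apply: orbit_refl.
  by rewrite degG leq_pmul2r.
have fix_mod g : g \in P -> #|'Fix_'P[g]| = 0 %[mod p].
  move=> Pg; have pg : p.-group <[g]> by apply: pgroupS pP; rewrite cycle_subG.
  have := pgroup_fix_mod pg (acts_setT <[g]>).
  rewrite cardsT degG mod0n modnMl setTI => ->.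
  by rewrite afix_cycle.
have [x Px fix0] : exists2 x, x \in P & 'Fix_'P[x] = set0.
  suff /exists_inP[x Px /eqP] : [exists x in P, 'Fix_'P[x] == set0] by exists x.
  apply: contraLR orb3 => /exists_inPn noP.
  rewrite -ltnNge -(ltn_pmul2r (cardG_gt0 P)) -sum_fix_orbits.
  apply: (@leq_trans (\sum_(g in P) p)); last first.
    apply: leq_sum => g Pg; rewrite dvdn_leq //.
      by rewrite card_gt0; apply: noP.
    by rewrite /dvdn fix_mod // mod0n.
  rewrite sum_nat_const mulnC ltn_pmul2l ?cardG_gt0 //.
  by apply: leq_trans p_ge5.
have pX : p.-group <[x]> by apply: pgroupS pP; rewrite cycle_subG.
exists x; first exact: subsetP Px.
have no_fix a : x a != a.
  apply/eqP=> xa; have : a \in 'Fix_'P[x] by apply/afix1P; rewrite /= apermE.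
  by rewrite fix0 inE.
(* Cycle lengths are powers of p; 1 is excluded by the absence of fixed points, and p^2 or more
   would exceed 3p. *)
have orb_x a : #|porbit x a| = p.
  have : (#|porbit x a| %| #[x])%N by rewrite porbitE orderE dvdn_orbit.
  have [k oxk] := p_natP pX; rewrite orderE oxk.
  case/(dvdn_pfactor _ _ p_prime) => [[|[|m]]] _ cardO //; last first.
    have : (#|porbit x a| <= 3 * p)%N by rewrite -degG max_card.
    have : (p * p <= #|porbit x a|)%N.
      by rewrite cardO !expnS mulnA leq_pmulr ?expn_gt0 ?p_gt0.
    move=> /leq_trans/[apply]; rewrite leq_pmul2r // => /(leq_trans p_ge5).
    by [].
  have := iter_porbit x a; rewrite cardO /= => /eqP.
  by rewrite (negPf (no_fix a)).
have xp1 : (x ^+ p)%g = 1%g.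
  by apply/permP=> a; rewrite permX perm1 -[X in iter X](orb_x a) iter_porbit.
have ox : #[x] = p.
  have : (#[x] %| p)%N by rewrite order_dvdn xp1.
  case/primeP: p_prime => _ /[apply] /pred2P[|//].
  move=> /eqP; rewrite order_eq1 => /eqP x1.
  have : (0 < #|T|)%N by rewrite degG muln_gt0.
  by case/card_gt0P=> a _; have := no_fix a; rewrite x1 perm1 eqxx.
split=> // h a Xh fixh; apply/set1gP.
have /prime_TIg TI : prime #|<[x]>| by rewrite -orderE ox.
rewrite -(TI 'C[a | 'P]%G).
  by apply/setIP; split; [exact: Xh | apply/astab1P; rewrite /= apermE; exact: fixh].
by rewrite cycle_subG; apply: contra (no_fix a) => /astab1P /=; rewrite apermE => ->.
Qed.
End SemiregularElement.

(** * Galois action, integrality and trace congruences *)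

Lemma char_aut_expX (gT : finGroupType) (G : {group gT}) (chi : 'CF(G)) x k
    (u : {rmorphism algC -> algC}) :
  chi \is a character -> x \in G -> (forall z, z ^+ #[x] = 1 -> u z = z ^+ k) ->
  u (chi x) = chi (x ^+ k)%g.
Proof.
move=> Nchi Gx uP; have sXG : <[x]> \subset G by rewrite cycle_subG.
rewrite -(cfResE chi sXG (cycle_id x)) -(cfResE chi sXG (mem_cycle x k)).
(* On <x> the character is a sum of linear characters, whose values at [x] are roots of unity killed
   by the exponent [#[x]]. *)
have [r ->] := char_sum_irr (cfRes_char <[x]> Nchi).
rewrite !sum_cfunE rmorph_sum; apply: eq_bigr => i _ /=.
have Li : 'chi_i \is a linear_char by rewrite irr_cyclic_lin ?cycle_cyclic.
rewrite (lin_charX Li) ?cycle_id // uP // -(lin_charX Li) ?cycle_id //.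
by rewrite expg_order lin_char1.
Qed.

(** A nonzero row of [V] is an eigenvector, and the characteristic polynomial of an integer matrix
    is monic with integer coefficients. *)
Lemma eigenvalue_Aint n m (A : 'M[algC]_n) (V : 'M_(m, n)) c :
  (forall u v, A u v \in Num.int) -> V *m A = c *: V -> V != 0 -> c \in Aint.
Proof.
move=> intA VA V_neq0.
have [u rowV] : exists u, row u V != 0.
  apply/existsP; apply: contraNT V_neq0; rewrite negb_exists => /forallP V0.
  by apply/eqP/row_matrixP=> u; rewrite row0; apply/eqP; rewrite -[_ == _]negbK.
have eigA : eigenvalue A c.
  by apply/eigenvalueP; exists (row u V); rewrite // -row_mul VA linearZ.
have DA : A = map_mx intr (map_mx Num.floor A).
  by apply/matrixP=> v w; rewrite !mxE floorK.
apply: root_monic_Aint (char_poly_monic A) _; first by rewrite -eigenvalue_root_char.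
rewrite DA -map_char_poly; apply/polyOverP=> l; rewrite coef_map.
by rewrite intr_int.
Qed.

(** Here q = p - 1 and z is the sum of the eigenvalues of an orbital matrix on the two constituents
    of degree q; the hypothesis says that its trace is 0. *)
Lemma trace_congruence (R : comNzRingType) (q d b z : R) :
  d + 2 * b + (d - b) * (q + 2) + z * q = 0 -> 3 * d = (b - d - z) * q.
Proof.
move=> eq0; apply/eqP; rewrite -subr_eq0; apply/eqP.
by rewrite -[RHS]eq0; ring.
Qed.

(** Here y is the sum of the squared moduli of those eigenvalues. Modulo q, (d + 2b)^2 + 2(d - b)^2
    = 3d^2 + 6b^2 is congruent to 3d + 6b, and 3d to 0. *)
Lemma trace_square_congruence (R : comNzRingType) (q d b y z : R) :
    (d + 2 * b) ^+ 2 + (d - b) ^+ 2 * (q + 2) + y * q = (d + 2 * b) * (3 * (q + 1)) ->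
    3 * d = (b - d - z) * q ->
  6 * (b * (b - 1)) = (3 * (d + 2 * b) - (d - b) ^+ 2 - y + (b - d - z) * (1 - d)) * q.
Proof.
move=> eq_sqr eq_d; apply/eqP; rewrite -subr_eq0.
have -> : 6 * (b * (b - 1))
    - (3 * (d + 2 * b) - (d - b) ^+ 2 - y + (b - d - z) * (1 - d)) * q
  = (1 - d) * (3 * d - (b - d - z) * q) + ((d + 2 * b) ^+ 2 + (d - b) ^+ 2 * (q + 2)
      + y * q - (d + 2 * b) * (3 * (q + 1))) by ring.
by rewrite eq_sqr eq_d !subrr mulr0 addr0.
Qed.

(** * Restriction of the constituents to <x> *)

Section TypeVII.

Variables (T : finType) (G : {group {perm T}}) (p : nat) (i j k : Iirr G).
Hypotheses (p_prime : prime p) (p_ge5 : (5 <= p)%N) (degG : #|T| = (3 * p)%N).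
Hypothesis transG : [transitive G, on [set: T] | 'P].
Hypothesis neq_ijk : [/\ i != j, i != k & j != k].
Hypothesis perm_charVII : perm_char G = 1 + 'chi_i + 'chi_j + 'chi_k.
Hypothesis degVII :
  [/\ 'chi_i 1%g = p.+1%:R, 'chi_j 1%g = p.-1%:R & 'chi_k 1%g = p.-1%:R].
Implicit Types (a b c : T) (g h : {perm T}) (M N : 'M[algC]_#|T|).

Let K : {set Iirr G} := [set 0; i; j; k].

Let p_gt0 : (0 < p)%N. Proof. exact: prime_gt0. Qed.

Let p1_gt3 : (3 < p.-1)%N. Proof. by case: p p_ge5. Qed.

Let neq0 : [/\ i != 0, j != 0 & k != 0].
Proof.
have nz l m : 'chi_l 1%g = m%:R -> (1 < m)%N -> l != 0 :> Iirr G.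
  move=> Dl m_gt1; apply: contra_eq_neq Dl => ->; rewrite irr0 cfun11 eq_sym pnatr_eq1.
  by rewrite gtn_eqF.
have [di dj dk] := degVII.
have p1_gt1 := ltn_trans (isT : 1 < 3)%N p1_gt3.
split; first by apply: nz di _; rewrite ltnS p_gt0.
  exact: nz dj p1_gt1.
exact: nz dk p1_gt1.
Qed.

Lemma big_constituents (R : nmodType) (F : Iirr G -> R) :
  \sum_(l in K) F l = F 0 + F i + F j + F k.
Proof.
have [ij ik jk] := neq_ijk; have [i0 j0 k0] := neq0.
rewrite /K -!setUA !big_setU1 ?big_set1 /= ?addrA // !inE ?negb_or //.
- by rewrite ij ik.
- by rewrite ![0 == _]eq_sym i0 j0 k0.
Qed.

Let piE : perm_char G = \sum_(l in K) 'chi_l.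
Proof. by rewrite big_constituents irr0. Qed.

Let card_K : #|K| = 4.
Proof.
by rewrite -sum1_card big_constituents.
Qed.

(** The permutation character has integer values, so [u] permutes its constituents, and ['chi_i] is
    the only one of degree p + 1. *)
Lemma aut_Iirr_fix (u : {rmorphism algC -> algC}) : aut_Iirr u i = i.
Proof.
have perm_char_aut : cfAut u (perm_char G) = perm_char G.
  by apply/cfun_inP=> g Gg; rewrite cfunE /= perm_charE // rmorph_nat.
have constK l : '[perm_char G, 'chi_l] = (l \in K)%:R.
  rewrite piE cfdot_suml big_mkcond (bigD1 l) //= big1 ?addr0 => [|m ne].
    by rewrite cfdot_irr eqxx; case: ifP.
  by rewrite cfdot_irr (negPf ne) if_same.
have := constK (aut_Iirr u i).
rewrite -perm_char_aut aut_IirrE cfdot_aut_irr constK !inE eqxx orbT /= rmorph1.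
move/eqP; rewrite eq_sym pnatr_eq1 eqb1 => Ku.
have : 'chi_(aut_Iirr u i) 1%g = p.+1%:R by rewrite aut_IirrE cfAut_irr1; case: degVII.
case: degVII => _ dj dk.
have neq : p.+1%:R != p.-1%:R :> algC.
  by rewrite eqr_nat -(prednK p_gt0) gtn_eqF.
move: Ku => /orP[/orP[/orP[]|]|] /eqP ->.
- by rewrite irr0 cfun11 => /eqP; rewrite eq_sym pnatr_eq1 eqSS (gtn_eqF p_gt0).
- by [].
- by rewrite dj => /eqP; rewrite eq_sym (negPf neq).
- by rewrite dk => /eqP; rewrite eq_sym (negPf neq).
Qed.

Variable x : {perm T}.
Hypotheses (Gx : x \in G) (ox : #[x] = p).
Hypothesis semiregular_x : forall h a, h \in <[x]> -> h a = a -> h = 1%g.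

Let sXG : <[x]> \subset G. Proof. by rewrite cycle_subG. Qed.

Let pC_neq0 : p%:R != 0 :> algC. Proof. by rewrite pnatr_eq0 -lt0n. Qed.

Lemma chi_i_cycle h : h \in <[x]>^# -> 'chi_i h = 'chi_i x.
Proof.
case/setD1P=> h1 /cycleP[m Dh].
have co_mp : coprime m #[x].
  rewrite coprime_sym ox prime_coprime //; apply: contra h1.
  by rewrite -ox order_dvdn -Dh.
have [u uP] := Qn_aut_exists co_mp.
rewrite Dh -(char_aut_expX (irr_char i) Gx uP).
by rewrite -[in RHS](aut_Iirr_fix u) aut_IirrE cfunE.
Qed.

Definition fixdim l : algC := '['Res[<[x]>] 'chi[G]_l, 1].

Lemma fixdimE l : fixdim l = p%:R^-1 * \sum_(h in <[x]>) 'chi_l h.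
Proof.
rewrite /fixdim cfdotE -orderE ox; congr (_ * _); apply: eq_bigr => h Xh.
by rewrite cfun1E Xh rmorph1 mulr1 cfResE.
Qed.

Lemma fixdim_nat l : fixdim l \in Num.nat.
Proof. by rewrite Cnat_cfdot_char ?cfRes_char ?irr_char // cfun1_char. Qed.

(** By semiregularity the permutation character restricts to <x> as three times the regular
    character. *)
Lemma sum_fixdim : \sum_(l in K) fixdim l = 3.
Proof.
rewrite (eq_bigr _ (fun l _ => fixdimE l)) -mulr_sumr exchange_big /=.
rewrite (eq_bigr (fun h => perm_char G h)); last first.
  by move=> h _; rewrite piE sum_cfunE.
rewrite (bigD1 1%g) ?group1 //= big1 => [|h /andP[Xh h1]].
  rewrite perm_charE // addr0 (_ : 'Fix_'P[1%g] = [set: T]).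
    by rewrite cardsT degG natrM mulrC mulfK.
  by apply/setP=> a; rewrite [RHS]inE; apply/afix1P; rewrite /= apermE perm1.
rewrite perm_charE ?(subsetP sXG) // (_ : 'Fix_'P[h] = set0) ?cards0 //.
apply/setP=> a; rewrite [RHS]inE; apply: contraNF h1 => /afix1P /=.
by rewrite apermE => /(semiregular_x Xh)->.
Qed.

Lemma fixdim0 : fixdim 0 = 1.
Proof. by rewrite /fixdim irr0 cfRes_cfun1 cfnorm1. Qed.

(** ['chi_i] takes one integer value z on the generators of <x>, so the multiplicity f satisfies p f
    = p + 1 + (p - 1) z, that is, f is 2 modulo p - 1. As 0 <= f <= 2 and p - 1 > 3, f is 2. *)
Lemma fixdim_i : fixdim i = 2.
Proof.
have [f Df] := natrP (fixdim_nat i).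
have [fj Dfj] := natrP (fixdim_nat j).
have [fk Dfk] := natrP (fixdim_nat k).
have f_le2 : (f <= 2)%N.
  have /eqP : (1 + f + fj + fk)%:R = 3%:R :> algC.
    by rewrite -sum_fixdim big_constituents fixdim0 Df Dfj Dfk !natrD.
  by rewrite eqr_nat; lia.
have cardX1 : #|<[x]>^#| = p.-1.
  by have := cardsD1 1%g <[x]>; rewrite group1 -orderE ox => ->.
have p1_neq0 : p.-1%:R != 0 :> algC by rewrite pnatr_eq0 -lt0n; apply: ltn_trans p1_gt3.
have := fixdimE i; rewrite Df (big_setD1 1%g) ?group1 //=.
rewrite (eq_bigr _ chi_i_cycle) sumr_const cardX1; have [-> _ _] := degVII.
move=> /(canLR (mulVKf pC_neq0)) => eq_f.
have Dc : 'chi_i x = (p%:R * f%:R - p.+1%:R) / p.-1%:R.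
  by rewrite eq_f [p.+1%:R + _]addrC addrK -['chi_i x *+ _]mulr_natr mulfK.
have /intrP[z Dz] : 'chi_i x \in Num.int.
  rewrite Cint_rat_Aint ?Aint_irr // Dc.
  by rewrite rpred_div ?rpredB ?rpredM ?rpred_nat.
have eq_fz : (p.+1%:Z + z * p.-1%:Z = p%:Z * f%:Z)%R.
  apply/eqP; rewrite -(eqr_int algC) rmorphD !rmorphM /= -!pmulrn -Dz eq_f.
  by rewrite mulr_natr.
suff -> : f = 2 by [].
have eq_w : (f%:Z - 2 = p.-1%:Z * (z + 1 - f%:Z))%R.
  lia.
move: eq_w p1_gt3 f_le2; clear; move: (z + 1 - f%:Z)%R p.-1 => w q eq_w q_gt3 f_le2.
have [w_ge|[w0|w_le]] : (1 <= w \/ w = 0 \/ w <= -1)%R by lia.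
- by nia.
- by rewrite w0 in eq_w; lia.
- by nia.
Qed.

Lemma fixdim_jk : fixdim j = 0 /\ fixdim k = 0.
Proof.
have [fj Dfj] := natrP (fixdim_nat j).
have [fk Dfk] := natrP (fixdim_nat k).
have /eqP : (1 + 2 + fj + fk)%:R = 3%:R :> algC.
  by rewrite -sum_fixdim big_constituents fixdim0 fixdim_i Dfj Dfk !natrD.
rewrite eqr_nat => sf.
rewrite Dfj Dfk; have [-> ->] : fj = 0%N /\ fk = 0%N by lia.
by [].
Qed.

(** * The projection onto the vectors fixed by x *)

Local Notation E := (@idem_mx T G).

Definition fix_mx : 'M[algC]_#|T| := p%:R^-1 *: \sum_(h in <[x]>) act_mx h.

Lemma entry_fix_mx a b :
  entry fix_mx a b = p%:R^-1 * \sum_(h in <[x]>) (h a == b)%:R.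
Proof.
rewrite /fix_mx entryZ entry_sum; congr (_ * _).
by apply: eq_bigr => h _; rewrite entry_act_mx.
Qed.

Lemma fix_mx_adj a b : entry fix_mx b a = (entry fix_mx a b)^*.
Proof.
rewrite !entry_fix_mx rmorphM rmorph_sum /= fmorphV /= rmorph_nat; congr (_ * _).
rewrite (reindex_inj invg_inj) /=; apply: eq_big => [h | h _]; first exact: groupV.
by rewrite rmorph_nat (can2_eq (permKV h) (permK h)) eq_sym.
Qed.

Lemma act_mx_idem_comm g l : g \in G -> act_mx g *m E l = E l *m act_mx g.
Proof.
move=> Gg; apply: entryP => a b; rewrite entry_act_mull entry_act_mulr.
by rewrite -{1}(permKV g b) (idem_mx_invariant l).
Qed.

Lemma fix_mx_idem_comm l : fix_mx *m E l = E l *m fix_mx.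
Proof.
rewrite /fix_mx -(scalemxAl p%:R^-1) -(scalemxAr p%:R^-1) mulmx_suml mulmx_sumr.
congr (_ *: _).
by apply: eq_bigr => h /(subsetP sXG) Gh; apply: act_mx_idem_comm.
Qed.

Lemma act_fix_mx h : h \in <[x]> -> act_mx h *m fix_mx = fix_mx.
Proof.
move=> Xh; rewrite /fix_mx -scalemxAr mulmx_sumr; congr (_ *: _).
rewrite [RHS](reindex_inj (mulgI h)) /=; apply: eq_big => g; first by rewrite groupMl.
by rewrite act_mxM.
Qed.

Lemma fix_mx_sqr : fix_mx *m fix_mx = fix_mx.
Proof.
rewrite {1}/fix_mx -scalemxAl mulmx_suml (eq_bigr _ act_fix_mx) sumr_const.
by rewrite -orderE ox -scaler_nat scalerA mulVf ?scale1r.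
Qed.

Lemma trace_idem_fix l : l \in K -> \tr (E l *m fix_mx) = fixdim l.
Proof.
move=> Kl; rewrite /fix_mx -scalemxAr mulmx_sumr linearZ linear_sum /= fixdimE.
congr (_ * _); apply: eq_bigr => h /(subsetP sXG) Gh.
by rewrite (trace_idem_act piE) // Kl mul1r.
Qed.

(* E_l fix_mx is a self-adjoint idempotent of trace 0. *)
Lemma idem_fix_eq0 l : l \in K -> fixdim l = 0 -> E l *m fix_mx = 0.
Proof.
move=> Kl fix0; set N := E l *m fix_mx.
have N_adj a b : entry (fix_mx *m E l) b a = (entry N a b)^*.
  rewrite /N !entry_mul rmorph_sum; apply: eq_bigr => c _ /=.
  by rewrite rmorphM /= -idem_mx_adj -fix_mx_adj mulrC.
have N_sqr : N *m (fix_mx *m E l) = fix_mx *m E l.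
  rewrite /N -mulmxA (mulmxA fix_mx) fix_mx_sqr fix_mx_idem_comm mulmxA.
  by rewrite idem_mxM eqxx scale1r.
have sum0 : \sum_a \sum_b `|entry N a b| ^+ 2 = 0.
  rewrite -[RHS]fix0 -trace_idem_fix // -fix_mx_idem_comm -N_sqr trace_entry.
  apply: eq_bigr => a _; rewrite entry_mul; apply: eq_bigr => b _.
  by rewrite N_adj normCK.
apply: entryP => a b; rewrite -/N [RHS]mxE; apply/eqP.
have sqr_ge0 c d : 0 <= `|entry N c d| ^+ 2 by rewrite exprn_ge0.
have /psumr_eq0P := sum0; move=> /(_ (fun c _ => sumr_ge0 _ (fun d _ => sqr_ge0 c d))).
move=> /(_ a isT)/psumr_eq0P => /(_ (fun d _ => sqr_ge0 a d) b isT)/eqP.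
by rewrite expf_eq0 /= normr_eq0.
Qed.

Let T_gt0 : (0 < #|T|)%N. Proof. by rewrite degG muln_gt0. Qed.

Lemma entry_idem0 a b : entry (E 0) a b = (3 * p)%N%:R^-1.
Proof.
have [g Gg <-] := transG_exists transG b a.
have K0 : 0 \in K by rewrite !inE eqxx.
have -> : (3 * p)%N%:R^-1 = entry (E 0) b b.
  by rewrite (idem_mx_diag piE transG b K0) irr0 cfun11 mul1r degG.
rewrite -entry_act_mull; congr (entry _ _ _).
rewrite /idem_mx -scalemxAr mulmx_sumr irr0; congr (_ *: _).
rewrite [RHS](reindex_inj (mulgI g)) /=; apply: eq_big => h; first by rewrite groupMl.
by move=> Gh; rewrite !cfun1E !groupV groupM // Gh -scalemxAr act_mxM.
Qed.

Lemma constituent_in : [/\ 0 \in K, i \in K, j \in K & k \in K].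
Proof. by split; rewrite !inE eqxx ?orbT. Qed.

(** Only the idempotents 0 and [i] survive multiplication by [fix_mx]. Since the four idempotents
    sum to the identity, [E i *m fix_mx] is [fix_mx - E 0]. *)
Lemma comb_fix_mx (c : Iirr G -> algC) :
  (\sum_(l in K) c l *: E l) *m fix_mx = c 0 *: E 0 + c i *: (fix_mx - E 0).
Proof.
have [K0 Ki Kj Kk] := constituent_in; have [fj fk] := fixdim_jk.
have E0 : E 0 *m fix_mx = E 0.
  apply: entryP => a b; rewrite entry_idem0 entry_mul.
  under eq_bigr do rewrite entry_idem0.
  rewrite -mulr_sumr (eq_bigr (fun c => p%:R^-1 * \sum_(h in <[x]>) (h c == b)%:R)).
    rewrite -mulr_sumr exchange_big /=.
    rewrite (eq_bigr (fun _ => 1)) => [|h _].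
      by rewrite sumr_const -orderE ox mulVf ?mulr1.
    rewrite (bigD1 (h^-1%g b)) //= permKV eqxx big1 ?addr0 // => d ne.
    by rewrite (can2_eq (permK h) (permKV h)) (negPf ne).
  by move=> d _; rewrite entry_fix_mx.
have comb1 d : (\sum_(l in K) d l *: E l) *m fix_mx
             = d 0 *: E 0 + d i *: (E i *m fix_mx).
  rewrite big_constituents !mulmxDl -(scalemxAl (d 0)) -(scalemxAl (d i)).
  rewrite -(scalemxAl (d j)) -(scalemxAl (d k)) E0.
  by rewrite !(idem_fix_eq0 _ fj) ?(idem_fix_eq0 _ fk) // !scaler0 !addr0.
have [d D1] : exists d : Iirr G -> algC, 1%:M = \sum_(l in K) d l *: E l.
  have [a _] := card_gt0P T_gt0; apply: (invariant_span piE transG a) => g b e _.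
  by rewrite !entry1 (inj_eq perm_inj).
have d1 l : l \in K -> d l = 1.
  move=> Kl; have := comb_mul_idem d Kl; rewrite -D1 mul1mx => /eqP.
  rewrite -subr_eq0 -{1}[E l]scale1r -scalerBl scaler_eq0 subr_eq0.
  by rewrite (negPf (idem_mx_neq0 piE Kl)) orbF eq_sym => /eqP.
have := comb1 d; rewrite -D1 mul1mx !d1 // !scale1r => DPhi.
by rewrite comb1; congr (_ + _ *: _); rewrite [X in _ = X - _]DPhi addrC addKr.
Qed.

(** For a suborbit [S] of [a], the adjacency matrix of the corresponding orbital: its row at [a] is
    the indicator of [S], transported by G to the other rows. *)
Definition orbital_mx a (S : {set T}) : 'M[algC]_#|T| :=
  kernel_mx (fun b c => [exists g in G, (g b == a) && (g c \in S)]%:R).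

Lemma orbital_mx_invariant a S : mx_invariant G (orbital_mx a S).
Proof.
move=> g b c Gg; rewrite !entry_kernel; congr (nat_of_bool _)%:R.
apply/exists_inP/exists_inP=> [[h Gh hP] | [h Gh hP]].
  by exists (g * h)%g; rewrite ?groupM // !permM.
by exists (g^-1 * h)%g; rewrite ?groupM ?groupV // !permM !permK.
Qed.

Local Notation suborbits a := (orbit 'P 'C_G[a | 'P] @: [set: T]).

Lemma suborbit_act a S g b :
  S \in suborbits a -> g \in 'C_G[a | 'P] -> (g b \in S) = (b \in S).
Proof.
case/imsetP=> t _ -> Cg; rewrite -[g b]/(aperm b g).
exact: orbit_actr.
Qed.

Lemma entry_orbital a S c :
  S \in suborbits a -> entry (orbital_mx a S) a c = (c \in S)%:R.
Proof.
move=> aS; rewrite entry_kernel; congr (nat_of_bool _)%:R.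
apply/exists_inP/idP=> [[g Gg /andP[ga gc]] | Sc].
  by rewrite -(suborbit_act _ aS (_ : g \in _)) // in_point_stab Gg.
by exists 1%g; rewrite ?group1 // !perm1 eqxx.
Qed.

(** By semiregularity, the number of points of [S] in the <x>-orbit of [b]. *)
Definition hits (S : {set T}) b : nat := #|[set h in <[x]> | h b \in S]|.

Lemma entry_orbital_fix a S b :
  S \in suborbits a -> entry (orbital_mx a S *m fix_mx) a b = (hits S b)%:R / p%:R.
Proof.
move=> aS; rewrite entry_mul.
under eq_bigr do rewrite entry_orbital // entry_fix_mx mulrCA mulr_sumr.
rewrite -mulr_sumr mulrC exchange_big /=; congr (_ / _).
rewrite /hits -sum1_card natr_sum.
rewrite (reindex_inj invg_inj) /= [RHS]big_mkcond [LHS]big_mkcond /=.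
apply: eq_bigr => h _; rewrite inE groupV; case: (h \in _) => //=.
rewrite (bigD1 (h b)) //= permK eqxx mulr1 big1 ?addr0 => [|c ne]; first by case: (_ \in S).
by rewrite (can2_eq (permKV h) (permK h)) (negPf ne) mulr0.
Qed.

Lemma entry_fix_diag a : entry fix_mx a a = p%:R^-1.
Proof.
rewrite entry_fix_mx (bigD1 1%g) ?group1 //= perm1 eqxx big1 ?addr0 ?mulr1 // => h.
case/andP=> Xh h1; case: eqP => // /(semiregular_x Xh) h1'.
by rewrite h1' eqxx in h1.
Qed.

Lemma entry_fix_off a b : b \notin orbit 'P <[x]> a -> entry fix_mx a b = 0.
Proof.
move=> ab; rewrite entry_fix_mx big1 ?mulr0 // => h Xh.
case: eqP => // hab; case/negP: ab; rewrite -hab -[h a]/(aperm a h).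
exact: mem_orbit.
Qed.

(** * Eigenvalues of one orbital matrix *)

Section Suborbit.

Variables (a b0 : T) (S : {set T}).
Hypotheses (aS : S \in suborbits a) (ab0 : b0 \notin orbit 'P <[x]> a).
Local Notation M := (orbital_mx a S).
Local Notation d := (hits S a).
Local Notation b := (hits S b0).

Let pT_neq0 : (3 * p)%N%:R != 0 :> algC.
Proof. by rewrite -degG pnatr_eq0 -lt0n. Qed.

(** The entries of [M *m fix_mx] at (a, a) and (a, b0) give 3d = |S| + 2 c_i and 3b = |S| - c_i. The
    eigenvalues are algebraic integers because [M] has entries 0 and 1. *)
Lemma orbital_spectrum : exists c : Iirr G -> algC,
  [/\ forall l, l \in K -> c l \in Aint,
      M = \sum_(l in K) c l *: E l,
      c 0 = #|S|%:R & c i = d%:R - b%:R /\ #|S| = (d + 2 * b)%N].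
Proof.
have [K0 Ki Kj Kk] := constituent_in.
have [c Dc] := invariant_span piE transG a (@orbital_mx_invariant a S).
have c0E : c 0 = #|S|%:R.
  have := congr1 (fun N => entry N a a) (comb_mul_idem c K0).
  rewrite -Dc entry_mul (entryZ (c 0)) !entry_idem0.
  under eq_bigr do rewrite entry_idem0 entry_orbital //.
  rewrite -mulr_suml => /(mulIf _) <-; last by rewrite invr_eq0.
  by rewrite -sum1_card natr_sum [RHS]big_mkcond; apply: eq_bigr => t _; case: ifP.
have entry_fix t : (hits S t)%:R / p%:R
    = #|S|%:R / (3 * p)%N%:R + c i * (entry fix_mx a t - (3 * p)%N%:R^-1).
  rewrite -(entry_orbital_fix _ aS) Dc comb_fix_mx entryD (entryZ (c 0)) (entryZ (c i)).
  by rewrite entryB !entry_idem0 c0E.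
have dE := entry_fix a; rewrite entry_fix_diag natrM in dE.
have bE := entry_fix b0; rewrite entry_fix_off // natrM in bE.
have dE' : 3 * d%:R = #|S|%:R + 2 * c i.
  by rewrite -[d%:R](mulfK pC_neq0) mulrAC dE; field.
have bE' : 3 * b%:R = #|S|%:R - c i.
  by rewrite -[b%:R](mulfK pC_neq0) mulrAC bE; field.
exists c; split=> //.
  move=> l Kl; apply: (@eigenvalue_Aint _ _ M (E l)).
  - by move=> u v; rewrite mxE natr_int.
  - by rewrite [in LHS]Dc idem_comb_mul.
  - exact: idem_mx_neq0 piE _ Kl.
have three_neq0 : 3 != 0 :> algC by rewrite pnatr_eq0.
split.
  by apply: (mulfI three_neq0); rewrite mulrBr dE' bE'; ring.
apply/eqP; rewrite -(eqr_nat algC) natrD natrM; apply/eqP.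
apply: (mulfI three_neq0); rewrite mulrDr dE' mulrCA bE'; ring.
Qed.

Lemma entry_comb_adj (c : Iirr G -> algC) u v :
  entry (\sum_(l in K) (c l)^* *: E l) v u = (entry (\sum_(l in K) c l *: E l) u v)^*.
Proof.
rewrite !entry_sum rmorph_sum; apply: eq_bigr => l _ /=.
by rewrite (entryZ (c l)^*) (entryZ (c l)) rmorphM /= idem_mx_adj.
Qed.

Lemma entry_comb_diag (c : Iirr G -> algC) :
  entry (\sum_(l in K) c l *: E l) a a
    = (c 0 + c i * p.+1%:R + (c j + c k) * p.-1%:R) / (3 * p)%N%:R.
Proof.
have [K0 Ki Kj Kk] := constituent_in; have [di dj dk] := degVII.
rewrite big_constituents !entryD (entryZ (c 0)) (entryZ (c i)) (entryZ (c j)) (entryZ (c k)).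
rewrite !(idem_mx_diag piE transG a) // irr0 cfun11 di dj dk degG.
by rewrite mul1r !mulrDl !mulrA -!addrA.
Qed.

(** The diagonal entries of [M] and of [M] times its adjoint, which are 0 and |S|, give two trace
    identities. They make the sum of the last two eigenvalues, and that of their squared moduli,
    rational and hence integers; the congruences above then apply. *)
Lemma hits_dvd : a \notin S ->
  (p.-1 %| 3 * d)%N /\ (p.-1 %| 6 * (b * b.-1))%N.
Proof.
move=> Sa; have [c [Ac Dc c0E [ciE nE]]] := orbital_spectrum.
have [K0 Ki Kj Kk] := constituent_in.
have p1_neq0 : p.-1%:R != 0 :> algC by rewrite pnatr_eq0 -lt0n; apply: ltn_trans p1_gt3.
have eq1 : #|S|%:R + (d%:R - b%:R) * p.+1%:R + (c j + c k) * p.-1%:R = 0.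
  have := entry_comb_diag c; rewrite -Dc entry_orbital // (negPf Sa) c0E ciE.
  by move=> /esym/eqP; rewrite mulf_eq0 invr_eq0 (negPf pT_neq0) orbF => /eqP.
have eq2 : #|S|%:R ^+ 2 + (d%:R - b%:R) ^+ 2 * p.+1%:R
     + (c j * (c j)^* + c k * (c k)^*) * p.-1%:R = #|S|%:R * (3 * p)%N%:R.
  pose c' l := c l * (c l)^*.
  have DM : M *m (\sum_(l in K) (c l)^* *: E l) = \sum_(l in K) c' l *: E l.
    rewrite mulmx_sumr; apply: eq_bigr => l Kl.
    by rewrite -(scalemxAr (c l)^*) [in LHS]Dc comb_mul_idem // scalerA mulrC.
  have := congr1 (fun N => entry N a a) DM; rewrite entry_comb_diag entry_mul.
  have -> : \sum_t entry M a t * entry (\sum_(l in K) (c l)^* *: E l) t a = #|S|%:R.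
    rewrite -sum1_card natr_sum [RHS]big_mkcond; apply: eq_bigr => t _.
    rewrite entry_comb_adj -Dc entry_orbital // rmorph_nat.
    by case: (t \in S); rewrite ?mulr1 ?mul0r.
  move/(canLR (divfK pT_neq0)) => ->; rewrite /c' c0E ciE.
  by rewrite rmorphB !rmorph_nat !expr2.
have /intrP[z Dz] : c j + c k \in Num.int.
  apply: Cint_rat_Aint; last by rewrite rpredD ?Ac.
  have -> : c j + c k = - (#|S|%:R + (d%:R - b%:R) * p.+1%:R) / p.-1%:R.
    by apply: (canRL (mulfK p1_neq0)); apply/eqP; rewrite -addr_eq0 addrC eq1.
  by rewrite rpred_div ?rpredN ?rpredD ?rpredM ?rpredB ?rpred_nat.
have /intrP[y Dy] : c j * (c j)^* + c k * (c k)^* \in Num.int.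
  apply: Cint_rat_Aint.
    have -> : c j * (c j)^* + c k * (c k)^* =
       (#|S|%:R * (3 * p)%N%:R - (#|S|%:R ^+ 2 + (d%:R - b%:R) ^+ 2 * p.+1%:R)) / p.-1%:R.
      by apply: (canRL (mulfK p1_neq0)); rewrite -eq2 [RHS]addrC addKr.
    by rewrite rpred_div ?rpredB ?rpredD ?rpredM ?rpredX ?rpredB ?rpred_nat.
  by rewrite rpredD // rpredM ?Aint_aut ?Ac.
have nC : #|S|%:R = d%:R + 2 * b%:R :> algC by rewrite nE natrD natrM.
have int1 : (d%:Z + 2 * b%:Z + (d%:Z - b%:Z) * p.+1%:Z + z * p.-1%:Z = 0)%R.
  apply/eqP; rewrite -(eqr_int algC) !(rmorphD, rmorphM, rmorphN) /= -!pmulrn -Dz -nC.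
  by rewrite eq1.
have int2 : ((d%:Z + 2 * b%:Z) ^+ 2 + (d%:Z - b%:Z) ^+ 2 * p.+1%:Z + y * p.-1%:Z
            = (d%:Z + 2 * b%:Z) * (3 * p%:Z))%R.
  apply/eqP; rewrite -(eqr_int algC) !(rmorphD, rmorphM, rmorphN, rmorphXn) /=.
  by rewrite -!pmulrn -Dy -nC eq2 natrM.
have p1Z : p.+1%:Z = (p.-1%:Z + 2)%R by rewrite -{1}(prednK p_gt0); clear; lia.
have pZ : p%:Z = (p.-1%:Z + 1)%R by rewrite -{1}(prednK p_gt0); clear; lia.
rewrite p1Z in int1 int2; rewrite pZ in int2.
have d3 : (3 * d%:Z = (b%:Z - d%:Z - z) * p.-1%:Z)%R.
  exact: trace_congruence int1.
have b6 := trace_square_congruence int2 d3.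
split.
  have : (p.-1%:Z %| (3 * d)%N%:Z)%Z by apply/dvdzP; exists (b%:Z - d%:Z - z)%R; rewrite PoszM.
  by [].
have [-> // | b_gt0] := posnP b.
suff : (p.-1%:Z %| (6 * (b * b.-1))%N%:Z)%Z by [].
apply/dvdzP; eexists; apply: etrans b6; rewrite !PoszM; congr (_ * (_ * _))%R.
by rewrite -[in RHS](prednK b_gt0) -addn1 PoszD addrK.
Qed.

(** Compare the (a, a) entries of [E i] times the adjoint of [M] and of the conjugate of c_i times
    [E i]; the row of [E i] at [a] is constant on [S]. *)
Lemma entry_idem_suborbit t : t \in S ->
  entry (E i) a t = (d%:R - b%:R) * p.+1%:R / ((3 * p)%N%:R * #|S|%:R).
Proof.
move=> St; have [c [Ac Dc c0E [ciE nE]]] := orbital_spectrum.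
have [K0 Ki Kj Kk] := constituent_in; have [di _ _] := degVII.
have S_neq0 : #|S|%:R != 0 :> algC by rewrite pnatr_eq0 -lt0n; apply/card_gt0P; exists t.
have degC : #|T|%:R = (3 * p)%N%:R :> algC by rewrite degG.
have := congr1 (fun N => entry N a a) (idem_comb_mul (fun l => (c l)^*) Ki).
rewrite (entryZ (c i)^*) (idem_mx_diag piE transG a Ki) di degC ciE.
rewrite rmorphB !rmorph_nat entry_mul.
have -> : \sum_u entry (E i) a u * entry (\sum_(l in K) (c l)^* *: E l) u a
        = entry (E i) a t * #|S|%:R.
  rewrite -sum1_card natr_sum mulr_sumr [RHS]big_mkcond; apply: eq_bigr => u _.
  rewrite entry_comb_adj -Dc entry_orbital // rmorph_nat.
  case: ifP => Su; rewrite ?mulr0 ?mulr1 //.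
  case/imsetP: aS Su St => v _ -> Su St.
  by rewrite !(entry_suborbit (idem_mx_invariant i) (b := v)).
by move/(canRL (mulfK S_neq0)) => ->; field; rewrite ?S_neq0 ?pC_neq0.
Qed.

End Suborbit.

(** * Relations summed over the suborbits *)

Lemma suborbits_partition a : partition (suborbits a) [set: T].
Proof. exact: orbit_partition (acts_setT _). Qed.

Lemma card_suborbits4 a : #|suborbits a| = 4.
Proof. by rewrite (card_suborbits piE transG). Qed.

Lemma sum_hits a b : (\sum_(S in suborbits a) hits S b = p)%N.
Proof.
rewrite -[RHS]ox orderE -sum1_card.
pose orb h := orbit 'P 'C_G[a | 'P] (h b).
rewrite (partition_big orb (mem (suborbits a))) /=; last first.
  by move=> h _; apply: imset_f; rewrite inE.
apply: eq_bigr => S aS; rewrite /hits -sum1_card; apply: eq_bigl => h.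
rewrite inE; congr (_ && _); case/imsetP: aS => t _ ->.
by rewrite /orb orbit_eq_mem.
Qed.

Lemma orbit_point_stab a : orbit 'P 'C_G[a | 'P] a = [set a].
Proof.
apply/orbit1P/afixP=> g; rewrite in_point_stab => /andP[_ /eqP ga].
by rewrite /= apermE.
Qed.

Lemma suborbit1 a : [set a] \in suborbits a.
Proof. by apply/imsetP; exists a; rewrite ?inE ?orbit_point_stab. Qed.

Lemma hits1 a : hits [set a] a = 1%N.
Proof.
rewrite /hits -(cards1 (1%g : {perm T})); apply: eq_card => h.
rewrite !inE; apply/andP/eqP=> [[Xh /eqP/(semiregular_x Xh)] // | ->].
by rewrite group1 perm1.
Qed.

Lemma hits1_off a b : b \notin orbit 'P <[x]> a -> hits [set a] b = 0%N.
Proof.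
move=> ab; apply/eqP; rewrite cards_eq0; apply/eqP/setP=> h; rewrite !inE.
apply: contraNF ab => /andP[Xh /eqP <-]; rewrite orbit_sym -[h b]/(aperm b h).
exact: mem_orbit.
Qed.

(** This is the (a, a) entry of E_i^2 = E_i, summed suborbit by suborbit with the entries found in
    [entry_idem_suborbit]. *)
Lemma sum_suborbit_sqr a b : b \notin orbit 'P <[x]> a ->
  \sum_(S in suborbits a) ((hits S a)%:R - (hits S b)%:R) ^+ 2 / #|S|%:R
    = (3 * p)%N%:R / p.+1%:R :> algC.
Proof.
move=> ab; have [_ Ki _ _] := constituent_in; have [di _ _] := degVII.
have degC : #|T|%:R = (3 * p)%N%:R :> algC by rewrite degG.
have T_neq0 : (3 * p)%N%:R != 0 :> algC by rewrite -degC pnatr_eq0 -lt0n.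
have p1_neq0 : p.+1%:R != 0 :> algC by rewrite pnatr_eq0.
pose w : algC := p.+1%:R / (3 * p)%N%:R.
have w_neq0 : w != 0 by rewrite mulf_neq0 ?invr_eq0.
have eqw : \sum_(S in suborbits a) ((hits S a)%:R - (hits S b)%:R) ^+ 2 / #|S|%:R * w ^+ 2 = w.
  have := congr1 (fun N => entry N a a) (idem_mxM i i).
  rewrite eqxx scale1r (idem_mx_diag piE transG a Ki) di degC entry_mul => eq1.
  apply: etrans eq1.
  rewrite [RHS](eq_bigl (mem [set: T])); last by move=> t; apply/esym/in_setT.
  rewrite (set_partition_big _ (suborbits_partition a)) /=.
  apply: eq_bigr => S aS.
  have S_neq0 : #|S|%:R != 0 :> algC.
    case/imsetP: aS => t _ ->; rewrite pnatr_eq0 -lt0n; apply/card_gt0P.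
    by exists t; apply: orbit_refl.
  pose e := ((hits S a)%:R - (hits S b)%:R) * p.+1%:R / ((3 * p)%N%:R * #|S|%:R) : algC.
  rewrite (eq_bigr (fun _ => e ^+ 2)) => [|t St].
    rewrite sumr_const -mulr_natr /e /w; field.
    by rewrite S_neq0 pC_neq0.
  rewrite [X in _ * X]idem_mx_adj (entry_idem_suborbit aS ab St) -/e.
  rewrite (_ : e^* = e) ?expr2 //.
  by rewrite /e fmorph_div /= !rmorphM rmorphB /= !rmorph_nat.
have -> : (3 * p)%N%:R / p.+1%:R = w^-1 by rewrite /w invf_div.
apply: (mulIf (expf_neq0 2 w_neq0)); rewrite mulr_suml eqw.
by rewrite expr2 mulKf.
Qed.

Lemma exists_off_orbit a : exists b, b \notin orbit 'P <[x]> a.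
Proof.
apply/existsP; rewrite -negb_forall; apply/negP=> /forallP orbT'.
have : (#|T| <= #|orbit 'P <[x]> a|)%N by apply/subset_leq_card/subsetP=> b _; apply: orbT'.
have : (#|orbit 'P <[x]> a| <= p)%N by rewrite -ox orderE dvdn_leq ?dvdn_orbit.
move=> le1 le2; have := leq_trans le2 le1; rewrite degG.
by rewrite leqNgt -{1}[p]mul1n ltn_pmul2r.
Qed.

End TypeVII.

(** * Transfer to integers and conclusion *)

Lemma dvdn_Z_divide (q m : nat) : (q %| m)%N -> Z.divide (Z.of_nat q) (Z.of_nat m).
Proof. by case/dvdnP=> l ->; exists (Z.of_nat l); rewrite Nat2Z.inj_mul. Qed.

(** The summand 1 is the trivial suborbit's; moving it across turns 3P / (P + 1) into (2P - 1) / (P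
    + 1). *)
Lemma clear_denominators (F : fieldType) (P x1 x2 x3 n1 n2 n3 : F) :
    [/\ P + 1 != 0, n1 != 0, n2 != 0 & n3 != 0] ->
    1 + x1 ^+ 2 / n1 + x2 ^+ 2 / n2 + x3 ^+ 2 / n3 = 3 * P / (P + 1) ->
  (P + 1) * (x1 * x1 * n2 * n3 + x2 * x2 * n1 * n3 + x3 * x3 * n1 * n2)
    = (2 * P - 1) * (n1 * n2 * n3).
Proof.
case=> P1 n1_neq0 n2_neq0 n3_neq0 /eqP; rewrite -subr_eq0 => /eqP eq0.
apply/eqP; rewrite -subr_eq0.
have -> : (P + 1) * (x1 * x1 * n2 * n3 + x2 * x2 * n1 * n3 + x3 * x3 * n1 * n2)
    - (2 * P - 1) * (n1 * n2 * n3)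
  = (1 + x1 ^+ 2 / n1 + x2 ^+ 2 / n2 + x3 ^+ 2 / n3 - 3 * P / (P + 1))
    * ((P + 1) * n1 * n2 * n3).
  by field; rewrite P1 n1_neq0 n2_neq0 n3_neq0.
by rewrite eq0 mul0r.
Qed.

Lemma nat_feasible (p d1 d2 d3 b1 b2 b3 : nat) :
    (0 < p)%N -> (b1 + b2 + b3 = p)%N ->
    [/\ (p.-1 %| 6 * (b1 * b1.-1))%N, (p.-1 %| 6 * (b2 * b2.-1))%N
      & (p.-1 %| 6 * (b3 * b3.-1))%N] ->
    [/\ (0 < d1 + 2 * b1)%N, (0 < d2 + 2 * b2)%N & (0 < d3 + 2 * b3)%N] ->
    1 + (d1%:R - b1%:R) ^+ 2 / (d1 + 2 * b1)%N%:R + (d2%:R - b2%:R) ^+ 2 / (d2 + 2 * b2)%N%:R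
      + (d3%:R - b3%:R) ^+ 2 / (d3 + 2 * b3)%N%:R = (3 * p)%N%:R / p.+1%:R :> algC ->
  feasible (Z.of_nat p) (Z.of_nat d1) (Z.of_nat d2) (Z.of_nat d3)
    (Z.of_nat b1) (Z.of_nat b2) (Z.of_nat b3).
Proof.
move=> p_gt0 sb [db1 db2 db3] [n1 n2 n3] eqn.
have divb (b : nat) : (p.-1 %| 6 * (b * b.-1))%N ->
    Z.divide (Z.of_nat p - 1) (6 * (Z.of_nat b * (Z.of_nat b - 1))).
  case: b => [_ | b]; first by exists Z0; lia.
  move/dvdn_Z_divide; rewrite !Nat2Z.inj_mul.
  have -> : Z.of_nat p.-1 = Z.sub (Z.of_nat p) 1 by clear -p_gt0; lia.
  by have -> : Z.of_nat b = Z.sub (Z.of_nat b.+1) 1 by clear; lia.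
split; [by clear; lia | by clear -sb; lia | by split; apply: divb | | ].
  by clear -n1 n2 n3; lia.
have nz (m : nat) : (0 < m)%N -> m%:R != 0 :> algC by rewrite pnatr_eq0 lt0n.
have eqZ : ((p%:Z + 1) *
      ((d1%:Z - b1%:Z) * (d1%:Z - b1%:Z) * (d2%:Z + 2 * b2%:Z) * (d3%:Z + 2 * b3%:Z)
     + (d2%:Z - b2%:Z) * (d2%:Z - b2%:Z) * (d1%:Z + 2 * b1%:Z) * (d3%:Z + 2 * b3%:Z)
     + (d3%:Z - b3%:Z) * (d3%:Z - b3%:Z) * (d1%:Z + 2 * b1%:Z) * (d2%:Z + 2 * b2%:Z))
    = (2 * p%:Z - 1) * ((d1%:Z + 2 * b1%:Z) * (d2%:Z + 2 * b2%:Z) * (d3%:Z + 2 * b3%:Z)))%R.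
  apply/eqP; rewrite -(eqr_int algC) !(rmorphD, rmorphM, rmorphN) /= -!pmulrn.
  have nD (d b : nat) : (d + 2 * b)%N%:R = d%:R + 2 * b%:R :> algC by rewrite natrD natrM.
  apply/eqP; apply: (@clear_denominators algC p%:R _ _ _ (d1%:R + 2 * b1%:R)
                       (d2%:R + 2 * b2%:R) (d3%:R + 2 * b3%:R)).
    by rewrite -!nD natr1 !nz.
  by rewrite -!nD eqn natrM natr1.
rewrite !Z.pow_2_r; have := congr1 Z_of_int eqZ.
rewrite !(rmorphD, rmorphM, rmorphN) /=.
by [].
Qed.
Lemma subdegrees_admissible (p : nat) (T : finType) (G : {group {perm T}}) (a : T) :
    prime p -> (5 <= p)%N -> #|T| = (3 * p)%N ->
    [transitive G, on [set: T] | 'P] -> type_VII G p ->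
  exists n, admissible p n /\ perm_eq (subdegrees G a) (1%N :: n).
Proof.
move=> p_prime p_ge5 degG transG [i [j [k [neq_ijk piE degs]]]].
have p_gt0 := prime_gt0 p_prime.
have [x Gx [ox semireg]] := exists_semiregular p_prime p_ge5 degG transG.
have [b0 ab0] := exists_off_orbit p_prime degG ox a.
pose Sb := orbit 'P 'C_G[a | 'P] @: [set: T].
have aSb : [set a] \in enum Sb by rewrite mem_enum suborbit1.
have := card_suborbits4 p_prime p_ge5 transG neq_ijk piE degs a; rewrite cardE -/Sb.
have uniqS := enum_uniq Sb.
rewrite (perm_uniq (perm_to_rem aSb)) in uniqS.
rewrite (perm_size (perm_to_rem aSb)).
have enumS := perm_to_rem aSb.
have restS S : S \in rem [set a] (enum Sb) -> S \in Sb.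
  by move/mem_rem; rewrite mem_enum.
case: (rem _ _) restS uniqS enumS => [|S1 [|S2 [|S3 []]]] //= restS uniqS enumS _.
have sumS (R : nmodType) (F : {set T} -> R) :
    \sum_(S in Sb) F S = F [set a] + F S1 + F S2 + F S3.
  rewrite -big_enum (perm_big _ enumS) /= !big_cons big_nil addr0.
  by rewrite !addrA.
pose d S := hits x S a; pose b S := hits x S b0.
have SbP S : S \in [:: S1; S2; S3] -> [/\ #|S| = (d S + 2 * b S)%N, (0 < #|S|)%N,
    (p.-1 %| 3 * d S)%N & (p.-1 %| 6 * (b S * (b S).-1))%N].
  move=> restS_S; have SbS := restS S restS_S.
  have [c [_ _ _ [_ nE]]] := orbital_spectrum p_prime p_ge5 degG transG neq_ijk piE degs
                               Gx ox semireg SbS ab0.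
  have Sa : a \notin S.
    apply: contraL restS_S => Sa; suff -> : S = [set a] by case/andP: uniqS.
    move: Sa; case/imsetP: SbS => t _ ->; rewrite -orbit_eq_mem => /eqP <-.
    exact: orbit_point_stab.
  have [d3 b6] := hits_dvd p_prime p_ge5 degG transG neq_ijk piE degs Gx ox semireg SbS ab0 Sa.
  split=> //; case/imsetP: SbS => t _ ->; apply/card_gt0P.
  by exists t; apply: orbit_refl.
have [|n1 n1_gt0 dd1 db1] := SbP S1; first by rewrite !inE eqxx.
have [|n2 n2_gt0 dd2 db2] := SbP S2; first by rewrite !inE eqxx orbT.
have [|n3 n3_gt0 dd3 db3] := SbP S3; first by rewrite !inE eqxx !orbT.
exists [:: #|S1|; #|S2|; #|S3|]; split; last first.
  by rewrite /subdegrees /image_mem -(cards1 a); apply: (perm_map _ enumS).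
(* The trivial suborbit has d = 1 and b = 0, so the other three share p - 1 and p. *)
have sd : (d S1 + d S2 + d S3)%N = p.-1.
  have := sum_hits G ox a a; rewrite -/Sb sumS hits1 // /d.
  by move: (hits x S1 a) (hits x S2 a) (hits x S3 a); clear; lia.
have sb : (b S1 + b S2 + b S3)%N = p.
  by have := sum_hits G ox a b0; rewrite -/Sb sumS hits1_off.
have eqn := sum_suborbit_sqr p_prime p_ge5 degG transG neq_ijk piE degs Gx ox semireg ab0.
rewrite -/Sb sumS hits1 // hits1_off // cards1 subr0 expr1n divr1 n1 n2 n3 in eqn.
rewrite n1 in n1_gt0; rewrite n2 in n2_gt0; rewrite n3 in n3_gt0.
have F := nat_feasible p_gt0 sb (And3 db1 db2 db3) (And3 n1_gt0 n2_gt0 n3_gt0) eqn.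
have p1Z : Z.of_nat p.-1 = Z.sub (Z.of_nat p) 1 by clear -p_gt0; lia.
have divd (m : nat) : (p.-1 %| 3 * m)%N ->
    Z.divide (Z.sub (Z.of_nat p) 1) (Z.mul 3 (Z.of_nat m)).
  by move/dvdn_Z_divide; rewrite p1Z Nat2Z.inj_mul.
have p_odd : Z.of_nat p = Z.add (Z.mul 2 (Z.of_nat p./2)) 1.
  have : odd p by apply: contraLR p_ge5 => /(prime_oddPn p_prime) ->.
  by clear; lia.
have := feasible_admissible _ p_odd _ _ F.
have toN (u v : nat) : Z.to_nat (Z.add (Z.of_nat u) (Z.mul 2 (Z.of_nat v))) = (u + 2 * v)%N.
  by clear; lia.
rewrite !toN Nat2Z.id n1 n2 n3; apply.
- by clear -p_ge5; lia.
- by split; try (by clear; lia); rewrite -p1Z -sd; clear; lia.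
- by split; apply: divd.
Qed.

Local Close Scope ring_scope.
Local Close Scope group_scope.

Theorem theorem10p2 (p : nat) (T : finType) (G : {group {perm T}})
    (p_prime : prime p) (p_ge5 : 5 <= p)
    (degG : #|T| = (3 * p)%N)
    (primG : [primitive G, on [set: T] | 'P])
    (not2transG : ~~ [transitive^2 G, on [set: T] | 'P])
    (typeG : type_VII G p) :
  [\/ p = 7, p = 19 | p = 31] /\
  [/\ p = 7 -> forall a : T, perm_eq (subdegrees G a) [:: 1; 4; 8; 8],
      p = 19 -> forall a : T, perm_eq (subdegrees G a) [:: 1; 6; 20; 30]
    & p = 31 -> forall a : T, perm_eq (subdegrees G a) [:: 1; 20; 32; 40]].
Proof.
have transG : [transitive G, on [set: T] | 'P].
  by case/andP: primG.
have subP a := subdegrees_admissible a p_prime p_ge5 degG transG typeG.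
have /card_gt0P[a0 _] : 0 < #|T| by rewrite degG muln_gt0 (prime_gt0 p_prime).
have [n [adm _]] := subP a0.
split.
  by case/or3P: adm => /andP[/eqP-> _]; [constructor 1|constructor 2|constructor 3].
split=> pE a; have [m []] := subP a; rewrite pE /admissible /= ?orbF => m_perm /permPl->;
  by rewrite perm_cons.
Qed.
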